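(* Let $T$ be the class of typically real functions and $S_{\mathbb{R}}$ the class of normalized univalent functions with real coefficients. Then $T\subset H^p$ for all $0<p<1/2$. Moreover, for every $\alpha\in[0,2]$ there exists $f(z)=z+\sum_{n\ge2}a_nz^n$ in $S_{\mathbb{R}}$ with $a_2=\alpha$ and such that $f\notin H^{1/2}$.
   Context: $\mathbb{D}$ is the open unit disk. $S$ is the class of univalent (injective holomorphic) functions $f(z)=z+\sum_{n=2}^\infty a_nz^n$ in $\mathbb{D}$, and $S_{\mathbb{R}}\subset S$ consists of those with all coefficients $a_n$ real. $T$ is the class of functions $f$ holomorphic in $\mathbb{D}$, normalized by $f(0)=f'(0)-1=0$, that take real values on $(-1,1)$ and non-real values elsewhere in $\mathbb{D}$. For $0<p<\infty$ the Hardy space $H^p$ is the set of holomorphic $f$ in $\mathbb{D}$ with $\sup_{r<1}\int_0^{2\pi}|f(re^{i\theta})|^p\,d\theta<\infty$. *)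

(* Defs.v *)
(* A function on the open unit disk is represented by a total [f : C -> C];
   every predicate below only looks at the values of [f] on the disk. *)
From Stdlib Require Import Reals.
From Coquelicot Require Import Coquelicot.
Open Scope R_scope.

Definition in_disk (z : C) : Prop := Cmod z < 1.

Definition holomorphic_on_disk (f : C -> C) : Prop :=
  forall z : C, in_disk z ->
    ex_derive (K := C_AbsRing) (V := C_NormedModule) f z.

Definition univalent_on_disk (f : C -> C) : Prop :=
  holomorphic_on_disk f /\
  forall z w : C, in_disk z -> in_disk w -> f z = f w -> z = w.

(* [f z = z + sum_(n >= 2) a_n z^n] throughout the disk. *)
Definition normalized_expansion (f : C -> C) (a : nat -> C) : Prop :=
  a 0%nat = RtoC 0 /\ a 1%nat = RtoC 1 /\
  forall z : C, in_disk z ->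
    is_pseries (K := C_AbsRing) (V := C_NormedModule) a z (f z).

Definition class_S (f : C -> C) : Prop :=
  univalent_on_disk f /\ exists a : nat -> C, normalized_expansion f a.

Definition class_SR (f : C -> C) : Prop :=
  class_S f /\
  exists a : nat -> C, normalized_expansion f a /\ forall n, Im (a n) = 0.

Definition class_T (f : C -> C) : Prop :=
  holomorphic_on_disk f /\
  f (RtoC 0) = RtoC 0 /\
  is_derive (K := C_AbsRing) (V := C_NormedModule) f (RtoC 0) (RtoC 1) /\
  (forall z : C, in_disk z -> Im z = 0 -> Im (f z) = 0) /\
  (forall z : C, in_disk z -> Im z <> 0 -> Im (f z) <> 0).

(* [x^p] for [x >= 0] and [p > 0].  The case split is needed because
   [Rpower 0 p = exp (p * ln 0) = 1] with Stdlib's convention [ln 0 = 0]. *)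
Definition rpow (x p : R) : R :=
  if Req_EM_T x 0 then 0 else Rpower x p.

Definition circle_point (r t : R) : C := (r * cos t, r * sin t).

(* Meant for [0 < p].  For holomorphic [f] the integrand is continuous in [t],
   so that [RInt], total in Coquelicot, is the genuine integral. *)
Definition hardy (p : R) (f : C -> C) : Prop :=
  holomorphic_on_disk f /\
  exists M : R, forall r : R, 0 <= r < 1 ->
    RInt (fun t => rpow (Cmod (f (circle_point r t))) p) 0 (2 * PI) <= M.

(* Main.v *)
Require Import Defs.
From Stdlib Require Import Reals Lra Lia Ranalysis5 ClassicalEpsilon.
From Coquelicot Require Import Coquelicot.
Open Scope R_scope.

(** Membership in the Hardy spaces. For [f] in [T] the quotient [f z / z] omits the
    closed negative real axis: [f z = - s z] with [s >= 0] is excluded off the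
    real axis since [Im f] has the sign of [Im z], and on it since [f] increases
    along the diameter ([class_T_quotient_slit]). Hence for [p < 1/2] the principal power
    [H = (f z / z) ^ p] is holomorphic and [Re H >= cos (p pi) |H|]. The means of [Re H] over circles
    centered at the origin do not depend on the radius
    ([vertical_mean_invariant]) and are bounded on small circles, which bounds the
    means of [|f| ^ p].

    Holomorphy here means complex differentiability at each point, with nothing
    known about the continuity of the derivative. The mean value property therefore rests on
    Goursat's bisection argument ([green_defect_zero]), applied in the coordinates
    [log z], where an annulus becomes a rectangle and periodicity cancels two
    of the sides.

    Functions outside [H^(1/2)]. A function of [S_R] that grows like
    [(1 - z)^(-2)] at 1 is not in [H^(1/2)], because [1 / |1 - z|] has means of
    order [log (1 / (1 - r))]. Such a function is obtained by squaring: if [Y = z + b z^2 + ...]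
    is univalent with a simple pole at 1 and [Re Y > - 1 / (2 e)], then
    [f = Y + e Y^2] is univalent, has a double pole, and its second coefficient is
    [b + e]. For
      [Y = (1/4) z / (1 - z) + (3/4) z / (1 + c z)] with [c = 1 - 2 e] and [0 < e <= 1]
    everything reduces to Moebius maps with values in the right half-plane
    ([half_plane_map_injective], [half_plane_map_range]), and the second coefficient of [f] is
    [(5 e - 1) / 2], which takes all the values in [[0, 2]]. *)

(** * Goursat's theorem on rectangles *)

Lemma nested_intervals (x : nat -> R) (W : R) :
  (forall n, x n <= x (S n) <= x n + W / 2 ^ S n) ->
  exists u, forall n, x n <= u <= x n + W / 2 ^ n.
Proof.
intros Hx.
assert (Hpow : forall n, W / 2 ^ n = 2 * (W / 2 ^ S n)).
{ intros n; simpl; field. apply pow_nonzero; lra. }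
assert (Hup : forall k n, x n <= x (k + n)%nat).
{ induction k as [|k IH]; intros n; simpl; [lra|].
  specialize (IH n). specialize (Hx (k + n)%nat). lra. }
assert (Hdown : forall k n, x (k + n)%nat + W / 2 ^ (k + n) <= x n + W / 2 ^ n).
{ induction k as [|k IH]; intros n; simpl Nat.add; [lra|].
  specialize (IH n). specialize (Hx (k + n)%nat).
  specialize (Hpow (k + n)%nat). lra. }
assert (Hwid : forall n, 0 <= W / 2 ^ n).
{ intros n. specialize (Hpow n). specialize (Hx n). lra. }
assert (Hub : forall n m, x m <= x n + W / 2 ^ n).
{ intros n m. destruct (Nat.le_ge_cases m n) as [H|H].
  - specialize (Hup (n - m)%nat m). specialize (Hwid n).
    replace (n - m + m)%nat with n in Hup by lia. lra.
  - specialize (Hdown (m - n)%nat n). specialize (Hwid m).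
    replace (m - n + n)%nat with m in Hdown by lia. lra. }
destruct (completeness (fun r => exists n, r = x n)) as [u [Hu1 Hu2]].
- exists (x 0%nat + W / 2 ^ 0). intros r [n ->]. apply Hub.
- exists (x 0%nat), 0%nat. reflexivity.
- exists u. intros n. split.
  + apply Hu1. now exists n.
  + apply Hu2. intros r [m ->]. apply Hub.
Qed.

(** Bisection: a property inherited from the four quarters of a rectangle that
    failed on the whole would fail on nested rectangles shrinking to a point,
    where the local hypothesis gives it. *)
Lemma rectangle_induction (P : R -> R -> R -> R -> Prop) (x0 y0 W H : R) :
  (forall x y w h,
     P x y w h -> P (x + w) y w h -> P x (y + h) w h -> P (x + w) (y + h) w h ->
     P x y (2 * w) (2 * h)) ->
  (forall u v, x0 <= u <= x0 + W -> y0 <= v <= y0 + H ->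
     exists delta, 0 < delta /\ forall x y w h,
       x <= u <= x + w -> y <= v <= y + h -> w < delta -> h < delta ->
       P x y w h) ->
  0 <= W -> 0 <= H -> P x0 y0 W H.
Proof.
intros Hsplit Hloc HW HH.
apply NNPP; intros Hnot.
pose (w n := W / 2 ^ n). pose (h n := H / 2 ^ n).
assert (Hw2 : forall n, w n = 2 * w (S n)).
{ intros n; unfold w; simpl; field. apply pow_nonzero; lra. }
assert (Hh2 : forall n, h n = 2 * h (S n)).
{ intros n; unfold h; simpl; field. apply pow_nonzero; lra. }
assert (Hw0 : forall n, 0 <= w n).
{ intros n; unfold w. apply Rdiv_le_0_compat; [lra|apply pow_lt; lra]. }
assert (Hh0 : forall n, 0 <= h n).
{ intros n; unfold h. apply Rdiv_le_0_compat; [lra|apply pow_lt; lra]. }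
(* [next n q q']: the failing quarter at stage [n + 1] has lower left corner
   [q'], when the failing rectangle at stage [n] has corner [q]. *)
pose (next n (q q' : R * R) :=
  fst q <= fst q' <= fst q + w (S n) /\ snd q <= snd q' <= snd q + h (S n) /\
  ~ P (fst q') (snd q') (w (S n)) (h (S n))).
assert (Hnext : forall n q, ~ P (fst q) (snd q) (w n) (h n) ->
                exists q', next n q q').
{ intros n [x y] Hq; simpl in Hq.
  specialize (Hw2 n). specialize (Hh2 n).
  generalize (Hw0 (S n)), (Hh0 (S n)); intros Hw Hh.
  apply NNPP; intros Hno; apply Hq. rewrite Hw2, Hh2.
  apply Hsplit; apply NNPP; intros Hsub; apply Hno;
    [exists (x, y)|exists (x + w (S n), y)|exists (x, y + h (S n))
    |exists (x + w (S n), y + h (S n))];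
    unfold next; simpl; repeat split; try assumption; lra. }
pose (q := fix q (n : nat) : R * R :=
  match n with
  | O => (x0, y0)
  | S m => epsilon (inhabits (0, 0)) (next m (q m))
  end).
assert (Hq : forall n, ~ P (fst (q n)) (snd (q n)) (w n) (h n)).
{ induction n as [|n IH].
  - unfold w, h; simpl. now rewrite !Rdiv_1_r.
  - now destruct (epsilon_spec (inhabits (0, 0)) _ (Hnext n (q n) IH))
      as [_ [_ Hn]]. }
assert (Hqn : forall n, next n (q n) (q (S n))).
{ intros n. exact (epsilon_spec (inhabits (0, 0)) _ (Hnext n (q n) (Hq n))). }
destruct (nested_intervals (fun n => fst (q n)) W) as [u Hu].
{ intros n. apply (Hqn n). }
destruct (nested_intervals (fun n => snd (q n)) H) as [v Hv].
{ intros n. apply (Hqn n). }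
destruct (Hloc u v) as [delta [Hdelta HP]].
{ specialize (Hu 0%nat). simpl in Hu. now rewrite Rdiv_1_r in Hu. }
{ specialize (Hv 0%nat). simpl in Hv. now rewrite Rdiv_1_r in Hv. }
destruct (pow_lt_1_zero (/ 2)) with (y := delta / (1 + W + H)) as [n Hn].
{ rewrite Rabs_pos_eq; lra. }
{ apply Rdiv_lt_0_compat; lra. }
specialize (Hn n (le_n n)).
rewrite Rabs_pos_eq in Hn by (apply pow_le; lra).
rewrite pow_inv in Hn.
assert (Hp : 0 < / 2 ^ n) by (apply Rinv_0_lt_compat, pow_lt; lra).
apply Rmult_lt_compat_r with (r := 1 + W + H) in Hn; [|lra].
replace (delta / (1 + W + H) * (1 + W + H)) with delta in Hn by (field; lra).
apply (Hq n), HP.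
- apply Hu.
- apply Hv.
- unfold w, Rdiv. nra.
- unfold h, Rdiv. nra.
Qed.

Lemma ex_RInt_Rminus (f g : R -> R) a b :
  ex_RInt f a b -> ex_RInt g a b -> ex_RInt (fun t => f t - g t) a b.
Proof. exact (ex_RInt_minus (V := R_NormedModule) f g a b). Qed.

Lemma RInt_Rminus (f g : R -> R) a b :
  ex_RInt f a b -> ex_RInt g a b ->
  RInt (fun t => f t - g t) a b = RInt f a b - RInt g a b.
Proof. exact (RInt_minus (V := R_CompleteNormedModule) f g a b). Qed.

(** The counterclockwise boundary integral of [V dx + U dy], that is, the
    imaginary part of the integral of [(U + i V) dz]. *)
Definition green_defect (U V : R -> R -> R) (x y w h : R) : R :=
  RInt (fun t => U (x + w) t - U x t) y (y + h)
  - RInt (fun t => V t (y + h) - V t y) x (x + w).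

Lemma continuity_2d_slices (F : R -> R -> R) (x y : R) :
  continuity_2d_pt F x y ->
  continuous (fun t => F x t) y /\ continuous (fun t => F t y) x.
Proof.
intros HF. split; apply filterlim_locally; intros eps;
  destruct (HF eps) as [d Hd]; exists d; intros t Ht; apply Hd;
  try exact Ht; rewrite Rminus_diag, Rabs_R0; apply cond_pos.
Qed.

Section Rectangle.
Variables (U V : R -> R -> R) (x0 y0 W H : R).
Hypothesis HW : 0 <= W.
Hypothesis HH : 0 <= H.
(* The boundary integral is the double integral of [U_x - V_y], so that this is
   the one Cauchy-Riemann equation that makes it vanish. *)
Hypothesis half_CR : forall u v, x0 <= u <= x0 + W -> y0 <= v <= y0 + H ->
  exists A B D, differentiable_pt_lim U u v A B /\ differentiable_pt_lim V u v D A.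

Let int_U : forall x a b,
  x0 <= x <= x0 + W -> y0 <= a <= b -> b <= y0 + H -> ex_RInt (fun t => U x t) a b.
Proof.
intros x a b Hx Ha Hb.
apply (ex_RInt_continuous (V := R_CompleteNormedModule)). intros z Hz.
rewrite Rmin_left, Rmax_right in Hz by lra.
destruct (half_CR x z) as [A [B [D [HU _]]]]; [lra|lra|].
apply (continuity_2d_slices U x z), differentiable_continuity_pt.
now exists A, B.
Qed.

Let int_V : forall y a b,
  y0 <= y <= y0 + H -> x0 <= a <= b -> b <= x0 + W -> ex_RInt (fun t => V t y) a b.
Proof.
intros y a b Hy Ha Hb.
apply (ex_RInt_continuous (V := R_CompleteNormedModule)). intros z Hz.
rewrite Rmin_left, Rmax_right in Hz by lra.
destruct (half_CR z y) as [A [B [D [_ HV]]]]; [lra|lra|].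
apply (continuity_2d_slices V z y), differentiable_continuity_pt.
now exists D, A.
Qed.

Lemma green_defect_split x y w h :
  x0 <= x -> x + 2 * w <= x0 + W -> y0 <= y -> y + 2 * h <= y0 + H ->
  0 <= w -> 0 <= h ->
  green_defect U V x y (2 * w) (2 * h) =
    green_defect U V x y w h + green_defect U V (x + w) y w h
    + green_defect U V x (y + h) w h + green_defect U V (x + w) (y + h) w h.
Proof.
intros Hx Hxw Hy Hyh Hw Hh. unfold green_defect.
replace (x + 2 * w) with (x + w + w) in * by ring.
replace (y + 2 * h) with (y + h + h) in * by ring.
rewrite <- (RInt_Chasles (fun t => U _ t - U x t) y (y + h) (y + h + h)).
rewrite <- (RInt_Chasles (fun t => V t _ - V t y) x (x + w) (x + w + w)).
assert (EU : forall a b c d, x0 <= a <= x0 + W -> x0 <= b <= x0 + W ->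
   y0 <= c <= d -> d <= y0 + H ->
   RInt (fun t => U a t - U b t) c d = RInt (fun t => U a t) c d - RInt (fun t => U b t) c d).
{ intros. apply RInt_Rminus; apply int_U; lra. }
assert (EV : forall a b c d, y0 <= a <= y0 + H -> y0 <= b <= y0 + H ->
   x0 <= c <= d -> d <= x0 + W ->
   RInt (fun t => V t a - V t b) c d = RInt (fun t => V t a) c d - RInt (fun t => V t b) c d).
{ intros. apply RInt_Rminus; apply int_V; lra. }
rewrite !EU, !EV by lra. unfold plus; simpl; ring.
1, 2: apply ex_RInt_Rminus; apply int_V; lra.
all: apply ex_RInt_Rminus; apply int_U; lra.
Qed.

Lemma linear_integral_bound (g : R -> R) a b K e :
  a <= b -> ex_RInt g a b -> (forall t, a <= t <= b -> Rabs (g t - K) <= e) ->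
  Rabs (RInt g a b - K * (b - a)) <= e * (b - a).
Proof.
intros Hab Hg He.
replace (RInt g a b - K * (b - a)) with (RInt (fun t => g t - K) a b).
- rewrite (Rmult_comm e). apply abs_RInt_le_const; trivial.
  apply ex_RInt_Rminus; trivial. apply ex_RInt_const.
- replace (K * (b - a)) with (RInt (fun _ => K) a b).
  + apply RInt_Rminus; trivial. apply ex_RInt_const.
  + rewrite RInt_const. unfold scal; simpl; unfold mult; simpl. ring.
Qed.

(** The linear parts of [U] and [V] contribute [A w h - A h w = 0], so that only
    the remainders count: each is at most [eps * (w + h)], and they are integrated
    over a boundary of length [2 * (w + h)]. *)
Lemma green_defect_local u v eps :
  x0 <= u <= x0 + W -> y0 <= v <= y0 + H -> 0 < eps ->
  exists delta, 0 < delta /\ forall x y w h,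
    x <= u <= x + w -> y <= v <= y + h -> w < delta -> h < delta ->
    x0 <= x -> x + w <= x0 + W -> y0 <= y -> y + h <= y0 + H ->
    Rabs (green_defect U V x y w h) <= 4 * eps * (w + h) ^ 2.
Proof.
intros Hu Hv Heps.
destruct (half_CR u v Hu Hv) as [A [B [D [HU HV]]]].
destruct (HU (mkposreal eps Heps)) as [d1 Hd1].
destruct (HV (mkposreal eps Heps)) as [d2 Hd2]. simpl in Hd1, Hd2.
exists (Rmin d1 d2). split. { apply Rmin_pos; apply cond_pos. }
intros x y w h Hx Hy Hw Hh Hx0 Hx1 Hy0 Hy1.
assert (Hm1 := Rmin_l d1 d2). assert (Hm2 := Rmin_r d1 d2).
assert (Hclose : forall a b c, a <= b <= a + c -> forall t, a <= t <= a + c -> Rabs (t - b) <= c).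
{ intros a b c Hb t Ht. apply Rabs_le. lra. }
assert (HUe : forall s t, x <= s <= x + w -> y <= t <= y + h ->
   Rabs (U s t - U u v - (A * (s - u) + B * (t - v))) <= eps * (w + h)).
{ intros s t Hs Ht. assert (H1 := Hclose _ _ _ Hx s Hs). assert (H2 := Hclose _ _ _ Hy t Ht).
  eapply Rle_trans; [apply Hd1; lra|]. apply Rmult_le_compat_l; [lra|].
  apply Rmax_lub; lra. }
assert (HVe : forall s t, x <= s <= x + w -> y <= t <= y + h ->
   Rabs (V s t - V u v - (D * (s - u) + A * (t - v))) <= eps * (w + h)).
{ intros s t Hs Ht. assert (H1 := Hclose _ _ _ Hx s Hs). assert (H2 := Hclose _ _ _ Hy t Ht).
  eapply Rle_trans; [apply Hd2; lra|]. apply Rmult_le_compat_l; [lra|].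
  apply Rmax_lub; lra. }
assert (K1 : Rabs (RInt (fun t => U (x + w) t - U x t) y (y + h) - (A * w) * (y + h - y))
   <= (2 * eps * (w + h)) * (y + h - y)).
{ apply linear_integral_bound; [lra| |].
  - apply ex_RInt_Rminus; apply int_U; lra.
  - intros t Ht. assert (E1 := HUe (x + w) t). assert (E2 := HUe x t).
    apply Rabs_le. assert (F1 := E1 ltac:(lra) Ht). assert (F2 := E2 ltac:(lra) Ht).
    apply Rabs_le_between in F1. apply Rabs_le_between in F2. lra. }
assert (K2 : Rabs (RInt (fun t => V t (y + h) - V t y) x (x + w) - (A * h) * (x + w - x))
   <= (2 * eps * (w + h)) * (x + w - x)).
{ apply linear_integral_bound; [lra| |].
  - apply ex_RInt_Rminus; apply int_V; lra.
  - intros t Ht. assert (E1 := HVe t (y + h) Ht). assert (E2 := HVe t y Ht).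
    apply Rabs_le. assert (F1 := E1 ltac:(lra)). assert (F2 := E2 ltac:(lra)).
    apply Rabs_le_between in F1. apply Rabs_le_between in F2. lra. }
unfold green_defect. apply Rabs_le. apply Rabs_le_between in K1. apply Rabs_le_between in K2.
assert (0 <= eps * (w + h) ^ 2) by (apply Rmult_le_pos; [lra|apply pow2_ge_0]).
split; nra.
Qed.

(** Goursat's argument: the bound [4 * eps * (w + h) ^ 2] holds on small rectangles and
    passes from four quarters to the whole, since each quarter carries a
    fourth of [(w + h) ^ 2]; and [eps] is arbitrary. *)
Theorem green_defect_zero : green_defect U V x0 y0 W H = 0.
Proof.
assert (Hall : forall eps, 0 < eps -> Rabs (green_defect U V x0 y0 W H) <= 4 * eps * (W + H) ^ 2).
{ intros eps Heps.
  pose (P x y w h := 0 <= w -> 0 <= h ->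
    x0 <= x -> x + w <= x0 + W -> y0 <= y -> y + h <= y0 + H ->
    Rabs (green_defect U V x y w h) <= 4 * eps * (w + h) ^ 2).
  assert (HP : P x0 y0 W H).
  { apply rectangle_induction; trivial.
    - intros x y w h P1 P2 P3 P4 Hw Hh Hx Hxw Hy Hyh.
      unfold P in *. rewrite green_defect_split by lra.
      specialize (P1 ltac:(lra) ltac:(lra) ltac:(lra) ltac:(lra) ltac:(lra) ltac:(lra)).
      specialize (P2 ltac:(lra) ltac:(lra) ltac:(lra) ltac:(lra) ltac:(lra) ltac:(lra)).
      specialize (P3 ltac:(lra) ltac:(lra) ltac:(lra) ltac:(lra) ltac:(lra) ltac:(lra)).
      specialize (P4 ltac:(lra) ltac:(lra) ltac:(lra) ltac:(lra) ltac:(lra) ltac:(lra)).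
      apply Rabs_le_between in P1, P2, P3, P4.
      apply Rabs_le. nra.
    - intros u v Hu Hv. destruct (green_defect_local u v eps Hu Hv Heps) as [d [Hd Hd']].
      exists d. split; trivial. unfold P. intros. apply Hd'; trivial. }
  apply HP; lra. }
apply Rabs_eq_0. apply Rle_antisym; [|apply Rabs_pos].
apply Rnot_lt_le. intros Hpos.
set (G := Rabs _) in *.
assert (Hs := pow2_ge_0 (W + H)).
specialize (Hall (G / (8 * ((W + H) ^ 2 + 1)))).
assert (0 < G / (8 * ((W + H) ^ 2 + 1))) by (apply Rdiv_lt_0_compat; nra).
specialize (Hall H0).
assert (E : G / (8 * ((W + H) ^ 2 + 1)) * (8 * ((W + H) ^ 2 + 1)) = G) by (field; nra).
nra.
Qed.
End Rectangle.

(** * Complex derivatives and the exponential *)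

Definition is_Cderive (f : C -> C) (z l : C) : Prop :=
  is_derive (K := C_AbsRing) (V := C_NormedModule) f z l.

(** The complex numbers carry two normed-module structures, one with the balls of the
    product of two copies of [R] and one with those of the absolute value, and the
    rules for products and compositions are stated with the second one. *)
Lemma is_Cderive_AbsRing f z l :
  is_Cderive f z l <-> is_derive (K := C_AbsRing) (V := AbsRing_NormedModule C_AbsRing) f z l.
Proof. split; intros [_ H]; (split; [apply is_linear_scal_l|exact H]). Qed.

Lemma is_Cderive_eps (f : C -> C) (z l : C) :
  is_Cderive f z l <->
  forall eps, 0 < eps -> exists delta, 0 < delta /\ forall w, Cmod (w - z) < delta ->
    Cmod (f w - f z - (w - z) * l) <= eps * Cmod (w - z).
Proof.
split.
- intros [_ H] eps Heps.
  destruct (H z (fun P HP => HP) (mkposreal eps Heps)) as [d Hd].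
  exists d. split; [apply cond_pos|]. intros w Hw. exact (Hd w Hw).
- intros H. split; [apply is_linear_scal_l|].
  intros x Hx. rewrite <- (is_filter_lim_locally_unique (V := AbsRing_NormedModule C_AbsRing) z x Hx).
  intros [eps Heps]. destruct (H eps Heps) as [d [Hd Hd']].
  exists (mkposreal d Hd). intros w Hw. exact (Hd' w Hw).
Qed.

Lemma is_Cderive_mult (f g : C -> C) (z df dg : C) :
  is_Cderive f z df -> is_Cderive g z dg ->
  is_Cderive (fun w => f w * g w)%C z (df * g z + f z * dg)%C.
Proof.
rewrite !is_Cderive_AbsRing.
intros Hf Hg. exact (is_derive_mult (K := C_AbsRing) f g z df dg Hf Hg Cmult_comm).
Qed.

Lemma is_Cderive_plus (f g : C -> C) (z df dg : C) :
  is_Cderive f z df -> is_Cderive g z dg ->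
  is_Cderive (fun w => f w + g w)%C z (df + dg)%C.
Proof. exact (is_derive_plus (K := C_AbsRing) (V := C_NormedModule) f g z df dg). Qed.

Lemma is_Cderive_comp (f g : C -> C) (z df dg : C) :
  is_Cderive f (g z) df -> is_Cderive g z dg ->
  is_Cderive (fun w => f (g w)) z (dg * df)%C.
Proof.
rewrite (is_Cderive_AbsRing g).
exact (is_derive_comp (K := C_AbsRing) (V := C_NormedModule) f g z df dg).
Qed.

Lemma is_Cderive_const (a z : C) : is_Cderive (fun _ => a) z 0%C.
Proof. exact (is_derive_const (K := C_AbsRing) (V := C_NormedModule) a z). Qed.

Lemma is_Cderive_id (z : C) : is_Cderive (fun w => w) z 1%C.
Proof. rewrite is_Cderive_AbsRing. exact (is_derive_id (K := C_AbsRing) z). Qed.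

Lemma im_le_Cmod (z : C) : Rabs (Im z) <= Cmod z.
Proof. eapply Rle_trans; [apply Rmax_r|apply Rmax_Cmod]. Qed.

Lemma Cmod_le_Re_Im (z : C) : Cmod z <= Rabs (Re z) + Rabs (Im z).
Proof.
destruct z as [a b]. unfold Cmod; simpl.
apply Rsqr_incr_0_var; [|generalize (Rabs_pos a), (Rabs_pos b); lra].
rewrite Rsqr_sqrt by nra. unfold Rsqr.
generalize (Rabs_pos a) (Rabs_pos b) (pow2_abs a) (pow2_abs b). nra.
Qed.

Lemma is_Cderive_inv_at (z : C) : z <> 0%C -> is_Cderive Cinv z (- / (z * z))%C.
Proof.
intros Hz. apply is_Cderive_eps. intros eps Heps.
assert (Hm : 0 < Cmod z) by now apply Cmod_gt_0.
assert (Hm3 : 0 < Cmod z ^ 3) by (apply pow_lt; trivial).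
exists (Rmin (Cmod z / 2) (eps * Cmod z ^ 3 / 2)).
split. { apply Rmin_pos; [lra|]. apply Rdiv_lt_0_compat; [now apply Rmult_lt_0_compat|lra]. }
intros w Hw.
assert (H1 := Rmin_l (Cmod z / 2) (eps * Cmod z ^ 3 / 2)).
assert (H2 := Rmin_r (Cmod z / 2) (eps * Cmod z ^ 3 / 2)).
assert (Hwm : Cmod z / 2 <= Cmod w).
{ assert (T := Cmod_triangle w (z - w)). replace (w + (z - w))%C with z in T by ring.
  replace (z - w)%C with (- (w - z))%C in T by ring. rewrite Cmod_opp in T. lra. }
assert (Hw0 : w <> 0%C) by (apply Cmod_gt_0; lra).
replace (/ w - / z - (w - z) * - / (z * z))%C with ((w - z) * ((w - z) / (w * (z * z))))%C
  by (field; now split).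
rewrite Cmod_mult, Rmult_comm. apply Rmult_le_compat_r; [apply Cmod_ge_0|].
rewrite Cmod_div by (repeat apply Cmult_neq_0; trivial).
rewrite !Cmod_mult.
apply Rle_div_l. { apply Rmult_lt_0_compat; [lra|nra]. }
apply Rle_trans with (eps * Cmod z ^ 3 / 2); [lra|].
replace (eps * Cmod z ^ 3 / 2) with (eps * (Cmod z / 2 * (Cmod z * Cmod z))) by field.
apply Rmult_le_compat_l; [lra|]. apply Rmult_le_compat_r; [nra|lra].
Qed.

Lemma is_Cderive_inv (f : C -> C) (z l : C) :
  is_Cderive f z l -> f z <> 0%C -> is_Cderive (fun w => / f w)%C z (l * - / (f z * f z))%C.
Proof.
intros Hf Hz. apply (is_Cderive_comp Cinv f); trivial. now apply is_Cderive_inv_at.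
Qed.

(** A continuous local right inverse of [E] is differentiable: with
    [k = L w - L z], the increment [w - z = E (L w) - E (L z)] is
    [k * l + o(k)], so that [k] is comparable with [w - z]. *)
Lemma is_Cderive_inverse (E L : C -> C) (z l : C) :
  (exists delta, 0 < delta /\ forall w, Cmod (w - z) < delta -> E (L w) = w) ->
  (forall eps, 0 < eps -> exists delta, 0 < delta /\
     forall w, Cmod (w - z) < delta -> Cmod (L w - L z) < eps) ->
  is_Cderive E (L z) l -> l <> 0%C -> is_Cderive L z (/ l)%C.
Proof.
intros [d0 [Hd0 HEL]] Hcont HE Hl.
rewrite is_Cderive_eps in HE. apply is_Cderive_eps. intros eps Heps.
assert (Hm : 0 < Cmod l) by now apply Cmod_gt_0.
assert (Hm2 : 0 < Cmod l ^ 2) by (apply pow_lt; trivial).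
pose (eta := Rmin (Cmod l / 2) (eps * Cmod l ^ 2 / 2)).
assert (Heta : 0 < eta).
{ apply Rmin_pos; [lra|]. apply Rdiv_lt_0_compat; [now apply Rmult_lt_0_compat|lra]. }
assert (H1 : eta <= Cmod l / 2) by apply Rmin_l.
assert (H2 : eta <= eps * Cmod l ^ 2 / 2) by apply Rmin_r.
destruct (HE eta Heta) as [d1 [Hd1 HE1]].
destruct (Hcont d1 Hd1) as [d2 [Hd2 Hc]].
exists (Rmin d0 d2). split; [now apply Rmin_pos|]. intros w Hw.
assert (Hwd0 := Rmin_l d0 d2). assert (Hwd2 := Rmin_r d0 d2).
specialize (HE1 (L w) (Hc w ltac:(lra))).
rewrite (HEL w) in HE1 by lra.
rewrite (HEL z) in HE1 by (unfold Cminus; rewrite Cplus_opp_r, Cmod_0; lra).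
set (k := (L w - L z)%C) in *.
assert (Hk : Cmod k * Cmod l <= Cmod (w - z) + eta * Cmod k).
{ assert (T := Cmod_triangle (w - z) (- (w - z - k * l))).
  replace (w - z + - (w - z - k * l))%C with (k * l)%C in T by ring.
  rewrite Cmod_opp, Cmod_mult in T. lra. }
assert (Hk2 : Cmod k * Cmod l <= 2 * Cmod (w - z)).
{ assert (Hk0 := Cmod_ge_0 k). nra. }
replace (k - (w - z) * / l)%C with (- ((w - z - k * l) / l))%C by (field; trivial).
rewrite Cmod_opp, Cmod_div by trivial.
apply Rle_div_l; trivial.
apply Rle_trans with (1 := HE1).
assert (Hk0 := Cmod_ge_0 k).
apply Rle_trans with (eps * Cmod l ^ 2 / 2 * Cmod k); [now apply Rmult_le_compat_r|].
replace (eps * Cmod l ^ 2 / 2 * Cmod k) with (eps * Cmod l / 2 * (Cmod k * Cmod l)) by field.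
replace (eps * Cmod (w - z) * Cmod l) with (eps * Cmod l / 2 * (2 * Cmod (w - z))) by field.
apply Rmult_le_compat_l; trivial. nra.
Qed.

Definition Cexp (z : C) : C := (exp (Re z) * cos (Im z), exp (Re z) * sin (Im z)).

Lemma Cexp_plus (a b : C) : Cexp (a + b) = (Cexp a * Cexp b)%C.
Proof.
destruct a as [a1 a2], b as [b1 b2]. unfold Cexp, Cmult, Cplus; simpl.
rewrite exp_plus, cos_plus, sin_plus. f_equal; ring.
Qed.

Lemma Cexp_0 : Cexp 0%C = 1%C.
Proof. apply injective_projections; simpl; rewrite exp_0, ?cos_0, ?sin_0; ring. Qed.

Lemma Cmod_Cexp (z : C) : Cmod (Cexp z) = exp (Re z).
Proof.
unfold Cmod, Cexp; simpl.
replace (_ + _) with (Rsqr (exp (Re z))).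
- apply sqrt_Rsqr, Rlt_le, exp_pos.
- transitivity (Rsqr (exp (Re z)) * (Rsqr (sin (Im z)) + Rsqr (cos (Im z)))).
  + rewrite sin2_cos2. ring.
  + unfold Rsqr. ring.
Qed.

Lemma Cexp_neq_0 (z : C) : Cexp z <> 0%C.
Proof. apply Cmod_gt_0. rewrite Cmod_Cexp. apply exp_pos. Qed.

Lemma is_derive_0_eps (f : R -> R) (l eps : R) : is_derive f 0 l -> 0 < eps ->
  exists delta, 0 < delta /\ forall h, Rabs h < delta -> Rabs (f h - f 0 - l * h) <= eps * Rabs h.
Proof.
intros [_ H] Heps. destruct (H 0 (fun P HP => HP) (mkposreal eps Heps)) as [d Hd].
exists d. split; [apply cond_pos|]. intros h Hh.
specialize (Hd h). unfold minus, plus, opp, scal, norm, ball in Hd; simpl in Hd.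
unfold AbsRing_ball, abs, minus, plus, opp, mult in Hd; simpl in Hd; unfold mult in Hd; simpl in Hd.
replace (f h - f 0 - l * h) with (f h + - f 0 + - ((h + - 0) * l)) by ring.
replace (Rabs h) with (Rabs (h + -0)) by (f_equal; ring).
apply Hd. now replace (h + - 0) with h by ring.
Qed.

Lemma is_Cderive_Cexp_0 : is_Cderive Cexp 0%C 1%C.
Proof.
apply is_Cderive_eps. intros eps Heps.
destruct (is_derive_0_eps exp 1 (eps / 6)) as [d1 [Hd1 E1]].
{ replace 1 with (exp 0) by apply exp_0. apply is_derive_exp. } { lra. }
destruct (is_derive_0_eps cos 0 (eps / 6)) as [d2 [Hd2 E2]].
{ replace 0 with (- sin 0) at 2 by (rewrite sin_0; ring). apply is_derive_cos. } { lra. }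
destruct (is_derive_0_eps sin 1 (eps / 6)) as [d3 [Hd3 E3]].
{ replace 1 with (cos 0) by apply cos_0. apply is_derive_sin. } { lra. }
rewrite exp_0 in E1. rewrite cos_0 in E2. rewrite sin_0 in E3.
pose (d := Rmin (Rmin d1 d2) (Rmin d3 (Rmin 1 (eps / 6)))).
exists d.
split. { repeat apply Rmin_pos; lra. }
intros h Hh. replace (h - 0)%C with h in * by ring.
assert (Ha : Rabs (Re h) <= Cmod h) by apply re_le_Cmod.
assert (Hb : Rabs (Im h) <= Cmod h) by apply im_le_Cmod.
destruct h as [a b]. simpl in Ha, Hb. set (m := Cmod (a, b)) in *.
assert (Hd1' : d <= d1) by (eapply Rle_trans; [apply Rmin_l|apply Rmin_l]).
assert (Hd2' : d <= d2) by (eapply Rle_trans; [apply Rmin_l|apply Rmin_r]).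
assert (Hd3' : d <= d3) by (eapply Rle_trans; [apply Rmin_r|apply Rmin_l]).
assert (Hd4' : d <= 1).
{ eapply Rle_trans; [apply Rmin_r|]. eapply Rle_trans; [apply Rmin_r|apply Rmin_l]. }
assert (Hd5' : d <= eps / 6).
{ eapply Rle_trans; [apply Rmin_r|]. eapply Rle_trans; [apply Rmin_r|apply Rmin_r]. }
specialize (E1 a ltac:(lra)). specialize (E2 b ltac:(lra)). specialize (E3 b ltac:(lra)).
assert (Hm : 0 <= m) by apply Cmod_ge_0.
rewrite Cexp_0.
(* [e^a e^(ib) - 1 - a - ib] as [(e^a - 1 - a) e^(ib)] plus
   [(1 + a) (e^(ib) - 1 - ib)] plus [i a b]; the three terms cost at most one,
   four and one times [eps / 6 * m]. *)
replace (Cexp (a, b) - 1 - (a, b) * 1)%C with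
  ((exp a - 1 - 1 * a)%R * Cexp (0%R, b)
   + ((1 + a)%R * ((cos b - 1 - 0 * b)%R, (sin b - 0 - 1 * b)%R) + (0%R, (a * b)%R)))%C.
2:{ apply injective_projections; simpl; rewrite exp_0; ring. }
eapply Rle_trans; [apply Cmod_triangle|]. rewrite Cmod_mult, Cmod_Cexp, Cmod_R; simpl Re.
rewrite exp_0.
assert (T2 := Cmod_triangle ((1 + a)%R * ((cos b - 1 - 0 * b)%R, (sin b - 0 - 1 * b)%R)) (0, a * b)).
rewrite Cmod_mult, Cmod_R in T2.
assert (T3 := Cmod_le_Re_Im ((cos b - 1 - 0 * b)%R, (sin b - 0 - 1 * b)%R)). simpl in T3.
assert (T4 := Cmod_le_Re_Im (0, a * b)). simpl in T4. rewrite Rabs_R0, Rabs_mult in T4.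
assert (T5 : Rabs (1 + a) <= 2).
{ eapply Rle_trans; [apply Rabs_triang|]. rewrite Rabs_R1. lra. }
assert (T6 : Rabs a * Rabs b <= eps / 6 * m).
{ apply Rmult_le_compat; try apply Rabs_pos; lra. }
assert (T7 : Rabs (1 + a) * Cmod ((cos b - 1 - 0 * b)%R, (sin b - 0 - 1 * b)%R) <= 2 * (2 * (eps / 6 * m))).
{ apply Rmult_le_compat; try apply Rabs_pos; try apply Cmod_ge_0; trivial.
  assert (eps / 6 * Rabs b <= eps / 6 * m) by (apply Rmult_le_compat_l; lra). lra. }
assert (T8 : eps / 6 * Rabs a <= eps / 6 * m) by (apply Rmult_le_compat_l; lra).
lra.
Qed.

Lemma is_Cderive_Cexp (z : C) : is_Cderive Cexp z (Cexp z).
Proof.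
assert (H := is_Cderive_Cexp_0). rewrite is_Cderive_eps in *.
intros eps Heps.
destruct (H (eps / exp (Re z))) as [d [Hd Hd']].
{ apply Rdiv_lt_0_compat; [trivial|apply exp_pos]. }
exists d. split; trivial. intros w Hw.
specialize (Hd' (w - z)%C). replace (w - z - 0)%C with (w - z)%C in Hd' by ring.
specialize (Hd' Hw).
replace (Cexp w - Cexp z - (w - z) * Cexp z)%C with (Cexp z * (Cexp (w - z) - Cexp 0 - (w - z) * 1))%C.
2:{ rewrite Cexp_0. replace w with (z + (w - z))%C at 3 by ring. rewrite Cexp_plus. ring. }
rewrite Cmod_mult, Cmod_Cexp.
apply Rle_trans with (exp (Re z) * (eps / exp (Re z) * Cmod (w - z))).
- apply Rmult_le_compat_l; [apply Rlt_le, exp_pos|trivial].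
- right. field. apply Rgt_not_eq, exp_pos.
Qed.

(** Continuity for the distance [Cmod (w - z)], the one that differentiability
    in the complex sense refers to. *)
Definition Ccontinuous_at (f : C -> R) (z : C) : Prop :=
  continuous (T := AbsRing_UniformSpace C_AbsRing) (U := R_UniformSpace) f z.

Lemma Ccontinuous_of_lipschitz (f : C -> R) (z : C) :
  (forall w, Rabs (f w - f z) <= Cmod (w - z)) -> Ccontinuous_at f z.
Proof.
intros H. apply filterlim_locally. intros eps. exists eps. intros w Hw.
exact (Rle_lt_trans _ _ _ (H w) Hw).
Qed.

Lemma Ccontinuous_Re z : Ccontinuous_at Re z.
Proof.
apply Ccontinuous_of_lipschitz. intros w. exact (re_le_Cmod (w - z)).
Qed.

Lemma Ccontinuous_Im z : Ccontinuous_at Im z.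
Proof.
apply Ccontinuous_of_lipschitz. intros w. exact (im_le_Cmod (w - z)).
Qed.

Lemma Cmod_minus_le (w z : C) : Rabs (Cmod w - Cmod z) <= Cmod (w - z).
Proof.
assert (T1 := Cmod_triangle (w - z) z). assert (T2 := Cmod_triangle (- (w - z)) w).
replace (w - z + z)%C with w in T1 by ring.
replace (- (w - z) + w)%C with z in T2 by ring. rewrite Cmod_opp in T2.
apply Rabs_le. lra.
Qed.

Lemma Ccontinuous_Cmod z : Ccontinuous_at Cmod z.
Proof. apply Ccontinuous_of_lipschitz. intros w. apply Cmod_minus_le. Qed.

(** * The principal logarithm *)

(** The plane without the closed negative real axis, because
    [Cmod z + Re z] vanishes exactly there. *)
Definition slit_plane (z : C) : Prop := 0 < Cmod z + Re z.

(** The principal logarithm: by the half-angle formula for the tangent,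
    the argument of [x + i y] is [2 * atan (y / (Cmod z + x))] on the slit plane. *)
Definition Clog (z : C) : C := (ln (Cmod z), 2 * atan (Im z / (Cmod z + Re z))).

Lemma slit_Cmod z : slit_plane z -> 0 < Cmod z.
Proof.
unfold slit_plane. intros H. generalize (re_le_Cmod z); intros H1.
apply Rabs_le_between in H1. lra.
Qed.

Lemma Clog_bound z : - PI < Im (Clog z) < PI.
Proof. unfold Clog; simpl. generalize (atan_bound (Im z / (Cmod z + Re z))). lra. Qed.

Lemma Cexp_Clog z : slit_plane z -> Cexp (Clog z) = z.
Proof.
intros Hs. assert (Hm := slit_Cmod z Hs).
unfold Cexp, Clog; simpl. rewrite exp_ln by trivial.
assert (H2 := Cmod2_alt z). unfold slit_plane in Hs.
destruct z as [x y]. simpl in *. set (m := Cmod (x, y)) in *.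
set (s := y / (m + x)). set (u := atan s).
assert (Hc : 0 < cos u) by (apply cos_gt_0; generalize (atan_bound s); fold u; lra).
assert (Hsin : sin u = s * cos u).
{ rewrite <- (tan_atan s). fold u. unfold tan. field. lra. }
(* The half-angle formulas, with [s] the tangent of half the argument. *)
assert (Hs2 : s * s * (m + x) = m - x).
{ unfold s. apply Rmult_eq_reg_r with (m + x); [|lra]. field_simplify; nra. }
assert (Hcos : cos u * cos u * (2 * m) = m + x).
{ generalize (sin2_cos2 u). unfold Rsqr. rewrite Hsin. intros E.
  assert (E2 : cos u * cos u * ((s * s) * (m + x) + (m + x)) = m + x).
  { transitivity ((s * cos u * (s * cos u) + cos u * cos u) * (m + x)); [ring|rewrite E; ring]. }
  rewrite Hs2 in E2. etransitivity; [|exact E2]. ring. }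
rewrite cos_2a_cos, sin_2a, Hsin. f_equal.
- nra.
- assert (Hy : s * (m + x) = y) by (unfold s; field; lra).
  rewrite <- Hy, <- Hcos. ring.
Qed.

Lemma Ccontinuous_pair_eps (f g : C -> R) (z : C) :
  Ccontinuous_at f z -> Ccontinuous_at g z ->
  forall eps, 0 < eps -> exists delta, 0 < delta /\
    forall w, Cmod (w - z) < delta -> Cmod ((f w, g w) - (f z, g z)) < eps.
Proof.
intros Hf Hg eps Heps.
assert (He2 : 0 < eps / 2) by lra.
destruct (proj1 (filterlim_locally _ _) Hf (mkposreal _ He2)) as [d1 H1].
destruct (proj1 (filterlim_locally _ _) Hg (mkposreal _ He2)) as [d2 H2].
exists (Rmin d1 d2). split; [apply Rmin_pos; apply cond_pos|].
intros w Hw.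
specialize (H1 w (Rlt_le_trans _ _ _ Hw (Rmin_l _ _))).
specialize (H2 w (Rlt_le_trans _ _ _ Hw (Rmin_r _ _))).
eapply Rle_lt_trans; [apply Cmod_le_Re_Im|].
change (Rabs (f w - f z) < eps / 2) in H1. change (Rabs (g w - g z) < eps / 2) in H2.
simpl. unfold Rminus in *. lra.
Qed.

Lemma is_Cderive_Clog (z : C) : slit_plane z -> is_Cderive Clog z (/ z)%C.
Proof.
intros Hs. assert (Hm := slit_Cmod z Hs).
assert (Hz : z <> 0%C) by now apply Cmod_gt_0.
assert (Hsum : forall w, Ccontinuous_at (fun w => Cmod w + Re w) w).
{ intros w. apply (continuous_plus (U := AbsRing_UniformSpace C_AbsRing) (V := R_NormedModule) Cmod Re).
  apply Ccontinuous_Cmod. apply Ccontinuous_Re. }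
apply (is_Cderive_inverse Cexp Clog).
- destruct (proj1 (filterlim_locally _ _) (Hsum z) (mkposreal _ Hs)) as [d Hd].
  exists d. split; [apply cond_pos|]. intros w Hw. apply Cexp_Clog.
  specialize (Hd w Hw).
  change (Rabs (Cmod w + Re w - (Cmod z + Re z)) < Cmod z + Re z) in Hd.
  apply Rabs_lt_between in Hd. unfold slit_plane. lra.
- apply Ccontinuous_pair_eps.
  + apply (continuous_comp (U := AbsRing_UniformSpace C_AbsRing) Cmod ln). apply Ccontinuous_Cmod.
    now apply continuous_ln.
  + apply (continuous_mult (U := AbsRing_UniformSpace C_AbsRing) (K := R_AbsRing) (fun _ => 2)).
    apply continuous_const.
    apply (continuous_comp (U := AbsRing_UniformSpace C_AbsRing) (fun w => Im w / (Cmod w + Re w)) atan).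
    * apply (continuous_mult (U := AbsRing_UniformSpace C_AbsRing) (K := R_AbsRing) Im). apply Ccontinuous_Im.
      apply (continuous_comp (U := AbsRing_UniformSpace C_AbsRing)
        (fun w => Cmod w + Re w) Rinv).
      apply Hsum. apply continuous_Rinv, Rgt_not_eq, Hs.
    * apply continuous_atan.
- rewrite <- (Cexp_Clog z Hs) at 2. apply is_Cderive_Cexp.
- trivial.
Qed.

(** * The mean value property *)

Lemma is_Cderive_half_CR (F : C -> C) (x y : R) (l : C) :
  is_Cderive F (x, y) l ->
  differentiable_pt_lim (fun u v => Re (F (u, v))) x y (Re l) (- Im l) /\
  differentiable_pt_lim (fun u v => Im (F (u, v))) x y (Im l) (Re l).
Proof.
intros HF. rewrite is_Cderive_eps in HF.
assert (Hs2 : 0 < sqrt 2) by (apply sqrt_lt_R0; lra).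
assert (Hcore : forall eps : posreal, locally_2d (fun u v =>
   Cmod (F (u, v) - F (x, y) - ((u, v) - (x, y)) * l) <= eps * Rmax (Rabs (u - x)) (Rabs (v - y))) x y).
{ intros eps. destruct (HF (eps / sqrt 2)) as [d [Hd H]].
  { apply Rdiv_lt_0_compat; [apply cond_pos|trivial]. }
  assert (Hd2 : 0 < d / sqrt 2) by now apply Rdiv_lt_0_compat.
  exists (mkposreal _ Hd2). simpl. intros u v Hu Hv.
  assert (Hm := Cmod_2Rmax ((u, v) - (x, y))%C). simpl in Hm.
  fold (u - x) in Hm. fold (v - y) in Hm.
  assert (Hmax : Rmax (Rabs (u - x)) (Rabs (v - y)) < d / sqrt 2) by now apply Rmax_lub_lt.
  eapply Rle_trans; [apply H|].
  - eapply Rle_lt_trans; [exact Hm|]. apply Rmult_lt_compat_l with (r := sqrt 2) in Hmax; trivial.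
    replace (sqrt 2 * (d / sqrt 2)) with d in Hmax by (field; lra). exact Hmax.
  - apply Rmult_le_compat_l with (r := eps / sqrt 2) in Hm.
    + replace (eps / sqrt 2 * (sqrt 2 * _)) with (eps * Rmax (Rabs (u - x)) (Rabs (v - y))) in Hm
        by (field; lra). exact Hm.
    + apply Rlt_le, Rdiv_lt_0_compat; [apply cond_pos|trivial]. }
split; intros eps; destruct (Hcore eps) as [d Hd]; exists d; intros u v Hu Hv;
  specialize (Hd u v Hu Hv); (eapply Rle_trans; [|exact Hd]).
- replace (_ - _ - _) with (Re (F (u, v) - F (x, y) - ((u, v) - (x, y)) * l)%C).
  apply re_le_Cmod. unfold Re, Im; simpl; ring.
- replace (_ - _ - _) with (Im (F (u, v) - F (x, y) - ((u, v) - (x, y)) * l)%C).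
  apply im_le_Cmod. unfold Re, Im; simpl; ring.
Qed.

(** The mean value property in logarithmic coordinates. In the rectangle
    [[x1, x2] x [0, 2 pi]] the integrals over the two horizontal sides cancel by
    periodicity, so that those over the vertical sides agree. For
    [F w = H (e^w)] the vertical integrals are the integrals of [H] over circles, and a
    singularity of [H] at the origin is pushed to infinity. *)
Lemma vertical_mean_invariant (F : C -> C) (x1 x2 : R) :
  (forall w, Re w < 0 -> exists l, is_Cderive F w l) ->
  (forall x y, F (x, y + 2 * PI) = F (x, y)) ->
  x1 <= x2 < 0 ->
  RInt (fun y => Re (F (x1, y))) 0 (2 * PI) = RInt (fun y => Re (F (x2, y))) 0 (2 * PI).
Proof.
intros HF Hper Hx. assert (HPI := PI_RGT_0).
assert (HG := green_defect_zero (fun u v => Re (F (u, v))) (fun u v => Im (F (u, v)))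
   x1 0 (x2 - x1) (2 * PI) ltac:(lra) ltac:(lra)).
assert (Hd : forall u v, u < 0 -> exists l, is_Cderive F (u, v) l).
{ intros u v Hu. now apply HF. }
assert (Hint : forall x, x < 0 -> ex_RInt (fun y => Re (F (x, y))) 0 (2 * PI)).
{ intros x Hxn. apply (ex_RInt_continuous (V := R_CompleteNormedModule)). intros y _.
  destruct (Hd x y Hxn) as [l Hl].
  apply (continuity_2d_slices (fun u v => Re (F (u, v))) x y), differentiable_continuity_pt.
  exists (Re l), (- Im l). now apply is_Cderive_half_CR. }
assert (HG0 := HG ltac:(
  intros u v Hu _; destruct (Hd u v ltac:(lra)) as [l Hl];
  exists (Re l), (- Im l), (Im l); now apply is_Cderive_half_CR)).
clear HG. unfold green_defect in HG0. rewrite !Rplus_0_l in HG0.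
replace (x1 + (x2 - x1)) with x2 in HG0 by ring.
rewrite RInt_Rminus in HG0 by (apply Hint; lra).
rewrite (RInt_ext (fun t => Im _ - Im _) (fun _ => 0) x1 x2) in HG0.
- rewrite RInt_const in HG0. unfold scal in HG0; simpl in HG0; unfold mult in HG0; simpl in HG0.
  lra.
- intros t _. rewrite <- (Rplus_0_l (2 * PI)), Hper. apply Rminus_diag_eq. reflexivity.
Qed.

(** * Typically real functions *)

Lemma holomorphic_is_Cderive f z :
  holomorphic_on_disk f -> in_disk z -> exists l, is_Cderive f z l.
Proof. intros Hf Hz. exact (Hf z Hz). Qed.

Lemma is_Cderive_continuous (g : C -> R) (f : C -> C) (z l : C) :
  (forall a b, Rabs (g a - g b) <= Cmod (a - b)) ->
  is_Cderive f z l -> Ccontinuous_at (fun w => g (f w)) z.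
Proof.
intros Hg Hf. rewrite is_Cderive_eps in Hf.
destruct (Hf 1 Rlt_0_1) as [d [Hd H]].
apply filterlim_locally. intros eps.
assert (Hl := Cmod_ge_0 l).
assert (Hd2 : 0 < Rmin d (eps / (2 + Cmod l))).
{ apply Rmin_pos; trivial. apply Rdiv_lt_0_compat; [apply cond_pos|lra]. }
exists (mkposreal _ Hd2). intros w Hw. change (Cmod (w - z) < Rmin d (eps / (2 + Cmod l))) in Hw.
change (Rabs (g (f w) - g (f z)) < eps).
eapply Rle_lt_trans; [apply Hg|].
assert (H1 := Rlt_le_trans _ _ _ Hw (Rmin_l _ _)).
assert (H2 := Rlt_le_trans _ _ _ Hw (Rmin_r _ _)).
specialize (H w H1).
assert (T := Cmod_triangle (f w - f z - (w - z) * l) ((w - z) * l)).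
replace (f w - f z - (w - z) * l + (w - z) * l)%C with (f w - f z)%C in T by ring.
rewrite Cmod_mult in T.
apply Rmult_lt_compat_r with (r := 2 + Cmod l) in H2; [|lra].
replace (eps / (2 + Cmod l) * (2 + Cmod l)) with (pos eps) in H2 by (field; lra).
generalize (Cmod_ge_0 (w - z)). nra.
Qed.

Lemma continuous_along_curve (g : C -> R) (f : C -> C) (x y : R -> R) (t : R) :
  (forall a b, Rabs (g a - g b) <= Cmod (a - b)) ->
  holomorphic_on_disk f -> in_disk (x t, y t) -> continuous x t -> continuous y t ->
  continuous (fun s => g (f (x s, y s))) t.
Proof.
intros Hg Hf Hz Hx Hy. destruct (holomorphic_is_Cderive f _ Hf Hz) as [l Hl].
apply (continuous_comp (V := AbsRing_UniformSpace C_AbsRing)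
  (fun s => (x s, y s)) (fun w => g (f w))).
- apply filterlim_locally. intros eps.
  assert (He2 : 0 < eps / 2) by (generalize (cond_pos eps); lra).
  assert (Fx := proj1 (filterlim_locally _ _) Hx (mkposreal _ He2)).
  assert (Fy := proj1 (filterlim_locally _ _) Hy (mkposreal _ He2)).
  generalize (filter_and _ _ Fx Fy). apply filter_imp. intros s [H1 H2].
  change (Rabs (x s - x t) < eps / 2) in H1. change (Rabs (y s - y t) < eps / 2) in H2.
  change (Cmod ((x s, y s) - (x t, y t)) < eps).
  eapply Rle_lt_trans; [apply Cmod_le_Re_Im|]. simpl. unfold Rminus in *. lra.
- now apply is_Cderive_continuous with l.
Qed.

Lemma Re_lipschitz (a b : C) : Rabs (Re a - Re b) <= Cmod (a - b).
Proof. exact (re_le_Cmod (a - b)). Qed.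

Lemma Im_lipschitz (a b : C) : Rabs (Im a - Im b) <= Cmod (a - b).
Proof. exact (im_le_Cmod (a - b)). Qed.

Definition ray (z : C) (s : R) : C := (s * Re z, s * Im z).

Lemma ray_1 z : ray z 1 = z.
Proof. destruct z as [x y]. unfold ray; simpl. now rewrite !Rmult_1_l. Qed.

Lemma Cmod_ray z s : 0 <= s -> Cmod (ray z s) = s * Cmod z.
Proof.
intros Hs. replace (ray z s) with (RtoC s * z)%C.
- rewrite Cmod_mult, Cmod_R, Rabs_pos_eq; trivial.
- apply injective_projections; simpl; unfold Re, Im; ring.
Qed.

Lemma ray_in_disk z s : in_disk z -> 0 <= s <= 1 -> in_disk (ray z s).
Proof.
intros Hz Hs. unfold in_disk in *. rewrite Cmod_ray by lra.
generalize (Cmod_ge_0 z). nra.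
Qed.

(** Since [f(0) = 0] and [f'(0) = 1], near the origin [f] sends each ray to a curve
    tangent to that ray. *)
Lemma ray_tangent f z eps : class_T f -> in_disk z -> 0 < eps ->
  exists d, 0 < d /\ forall s, 0 < s < d -> Cmod (f (ray z s) - ray z s) <= eps * s.
Proof.
intros [_ [H0 [H1 _]]] Hz Heps.
destruct (proj1 (is_Cderive_eps f 0%C 1%C) H1 eps Heps) as [d [Hd H]].
exists d. split; trivial. intros s Hs.
specialize (H (ray z s)). rewrite H0 in H.
replace (ray z s - 0)%C with (ray z s) in H by ring.
replace (f (ray z s) - 0 - ray z s * 1)%C with (f (ray z s) - ray z s)%C in H by ring.
unfold in_disk in Hz. assert (Hm := Cmod_ge_0 z). rewrite Cmod_ray in H by lra.
eapply Rle_trans; [apply H; nra|]. apply Rmult_le_compat_l; nra.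
Qed.

Lemma tangent_sign (a i s : R) :
  i <> 0 -> 0 < s -> Rabs (a - s * i) <= Rabs i / 2 * s -> 0 < a * i.
Proof.
intros Hi Hs H.
assert (H1 : Rabs ((a - s * i) * i) <= Rabs i / 2 * s * Rabs i).
{ rewrite Rabs_mult. apply Rmult_le_compat_r; [apply Rabs_pos|trivial]. }
replace (Rabs i / 2 * s * Rabs i) with (s / 2 * (Rabs i ^ 2)) in H1 by field.
rewrite pow2_abs in H1. apply Rabs_le_between in H1.
assert (H2 : 0 < i ^ 2) by (rewrite <- Rsqr_pow2; now apply Rsqr_pos_lt).
nra.
Qed.

(** Along the ray from the origin to [z] the product [Im f * Im z] is continuous, has no
    zero, and is positive near the origin because [f] is tangent to the identity
    there. *)
Lemma class_T_sign f z : class_T f -> in_disk z -> Im z <> 0 -> 0 < Im (f z) * Im z.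
Proof.
intros HT Hz Hi.
assert (Hhol := proj1 HT). assert (Hnr := proj2 (proj2 (proj2 (proj2 HT)))).
assert (Hi2 : 0 < Rabs (Im z)) by now apply Rabs_pos_lt.
assert (Hne : forall s, 0 < s <= 1 -> Im (f (ray z s)) * Im z <> 0).
{ intros s Hs. apply Rmult_integral_contrapositive. split; trivial.
  apply Hnr. apply ray_in_disk; trivial; lra.
  unfold ray; simpl. apply Rmult_integral_contrapositive. split; trivial; lra. }
apply Rnot_le_lt. intros Hle.
destruct (ray_tangent f z (Rabs (Im z) / 2)) as [d [Hd Htan]]; trivial; [lra|].
pose (s0 := Rmin (d / 2) (1 / 2)).
assert (Hs0 : 0 < s0) by (apply Rmin_pos; lra).
assert (Hs1 : s0 <= d / 2) by apply Rmin_l.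
assert (Hs2 : s0 <= 1 / 2) by apply Rmin_r.
assert (Hstart : 0 < Im (f (ray z s0)) * Im z).
{ assert (Ht := Htan s0 ltac:(lra)).
  assert (Hd1 := Rle_trans _ _ _ (Im_lipschitz (f (ray z s0)) (ray z s0)) Ht).
  now apply (tangent_sign _ _ s0). }
destruct (IVT_interv (fun s => - (Im (f (ray z s)) * Im z)) s0 1) as [s [Hs Hs3]].
- intros s Hs. apply continuity_pt_filterlim. apply (continuous_opp (V := R_NormedModule) (fun s => Im (f (ray z s)) * Im z)).
  apply (continuous_mult (K := R_AbsRing) (fun s => Im (f (ray z s)))); [|apply continuous_const].
  apply (continuous_along_curve Im f (fun s => s * Re z) (fun s => s * Im z)); trivial.
  + apply Im_lipschitz.
  + apply (ray_in_disk z s Hz). lra.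
  + apply (continuous_mult (K := R_AbsRing) (fun s => s)); [apply continuous_id|apply continuous_const].
  + apply (continuous_mult (K := R_AbsRing) (fun s => s)); [apply continuous_id|apply continuous_const].
- lra.
- lra.
- assert (H1 := Hne 1 ltac:(lra)). rewrite ray_1 in *. lra.
- apply (Hne s); lra.
Qed.

(** At a real point the derivative of [f] in the direction [i] points into the upper
    half-plane by [class_T_sign], so that [f'] is nonnegative there and [f] is monotone on
    the diameter; positivity is then inherited from the neighborhood of the
    origin. *)
Lemma class_T_sign_real f x : class_T f -> in_disk (x, 0) -> x <> 0 -> 0 < Re (f (x, 0)) * x.
Proof.
intros HT Hz Hx. assert (Hhol := proj1 HT).
assert (Hslope : forall s l, 0 <= s <= 1 -> is_Cderive f (s * x, 0) l -> 0 <= Re l).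
{ intros s l Hs Hl. apply Rnot_lt_le. intros Hneg.
  assert (Hp : in_disk (s * x, 0)).
  { replace (s * x, 0) with (ray (x, 0) s). apply ray_in_disk; trivial.
    unfold ray; simpl; f_equal; ring. }
  destruct (proj1 (is_Cderive_eps _ _ _) Hl (- Re l / 2)) as [d [Hd H]]; [lra|].
  unfold in_disk in Hp.
  pose (y := Rmin (d / 2) ((1 - Cmod (s * x, 0)) / 2)).
  assert (Hy : 0 < y) by (apply Rmin_pos; lra).
  assert (Hy1 : y <= d / 2) by apply Rmin_l.
  assert (Hy2 : y <= (1 - Cmod (s * x, 0)) / 2) by apply Rmin_r.
  assert (Ed : Cminus (s * x, y) (s * x, 0) = (0, y)).
  { apply injective_projections; simpl; ring. }
  assert (Em : Cmod (0, y) = y).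
  { unfold Cmod; simpl. replace (0 * (0 * 1) + y * (y * 1)) with (Rsqr y) by (unfold Rsqr; ring).
    apply sqrt_Rsqr. lra. }
  specialize (H (s * x, y)). rewrite Ed, Em in H. specialize (H ltac:(lra)).
  assert (Hin : in_disk (s * x, y)).
  { unfold in_disk. assert (T := Cmod_triangle (s * x, 0)%R (0, y)%R).
    replace (Cplus (s * x, 0) (0, y)) with (s * x, y) in T
      by (apply injective_projections; simpl; ring).
    rewrite Em in T. lra. }
  assert (Hpos := class_T_sign f (s * x, y) HT Hin ltac:(simpl; lra)). simpl in Hpos.
  assert (Hreal : Im (f (s * x, 0)) = 0) by now apply HT.
  apply (Rle_trans _ _ _ (im_le_Cmod _)) in H.
  replace (Im (f (s * x, y)%R - f (s * x, 0)%R - (0%R, y) * l)%C)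
    with (Im (f (s * x, y)) - Im (f (s * x, 0)) - y * Re l) in H
    by (unfold Im, Re; simpl; ring).
  rewrite Hreal in H. apply Rabs_le_between in H. nra. }
destruct (ray_tangent f (x, 0) (Rabs x / 2)) as [d [Hd Htan]]; trivial.
{ apply Rabs_pos_lt in Hx. lra. }
assert (Hx2 := Rabs_pos_lt x Hx).
pose (s0 := Rmin (d / 2) (1 / 2)).
assert (Hs0 : 0 < s0) by (apply Rmin_pos; lra).
assert (Hs1 : s0 <= d / 2) by apply Rmin_l.
assert (Hs2 : s0 <= 1 / 2) by apply Rmin_r.
assert (Hstart : 0 < Re (f (s0 * x, 0)) * x).
{ assert (Ht := Htan s0 ltac:(lra)).
  assert (Er : ray (x, 0) s0 = (s0 * x, 0)) by (unfold ray; simpl; f_equal; ring).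
  rewrite Er in Ht.
  assert (Hd1 := Rle_trans _ _ _ (Re_lipschitz (f (s0 * x, 0)) (s0 * x, 0)) Ht).
  now apply (tangent_sign _ _ s0). }
apply Rlt_le_trans with (1 := Hstart).
pose (h s := Re (f (s * x, 0)) * x).
assert (Hder : forall s, s0 <= s <= 1 ->
   0 <= Derive h s /\ derivable_pt_lim h s (Derive h s)).
{ intros s Hs.
  assert (Hp : in_disk (s * x, 0)).
  { replace (s * x, 0) with (ray (x, 0) s). apply ray_in_disk; trivial; lra.
    unfold ray; simpl; f_equal; ring. }
  destruct (holomorphic_is_Cderive f _ Hhol Hp) as [l Hl].
  assert (Hl0 := Hslope s l ltac:(lra) Hl).
  assert (Hh : derivable_pt_lim h s ((Re l * x + - Im l * 0) * x)).
  { apply derivable_pt_lim_scal_right.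
    apply (derivable_pt_lim_comp_2d (fun u v => Re (f (u, v))) (fun s => s * x) (fun _ => 0)).
    - now apply is_Cderive_half_CR.
    - apply is_derive_Reals. auto_derive; trivial. ring.
    - apply derivable_pt_lim_const. }
  assert (E := is_derive_unique _ _ _ (proj2 (is_derive_Reals _ _ _) Hh)).
  rewrite E. split; [nra|exact Hh]. }
destruct (MVT_cor2 h (Derive h) s0 1) as [s [E Hs]].
- lra.
- apply Hder.
- destruct (Hder s ltac:(lra)) as [Hd0 _]. unfold h in E at 1 2.
  rewrite Rmult_1_l in E. nra.
Qed.

(** An equation [f z = - s * z] with [s >= 0] contradicts [class_T_sign] off the real axis
    and [class_T_sign_real] on it. *)
Lemma class_T_quotient_slit f z : class_T f -> in_disk z -> z <> 0%C -> slit_plane (f z / z)%C.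
Proof.
intros HT Hz H0. unfold slit_plane. apply Rnot_le_lt. intros Hle.
set (q := (f z / z)%C) in *.
assert (Hf : f z = (q * z)%C) by (unfold q; field; trivial).
assert (Hre := re_le_Cmod q). apply Rabs_le_between in Hre.
assert (Hq := Cmod2_alt q).
assert (Hqre : Re q = - Cmod q) by lra.
assert (Hqi : Im q = 0).
{ rewrite Hqre in Hq. replace ((- Cmod q) ^ 2) with (Cmod q ^ 2) in Hq by ring. apply Rsqr_0_uniq. unfold Rsqr. lra. }
assert (Hqr : Re q <= 0) by (generalize (Cmod_ge_0 q); lra).
destruct z as [x y]. destruct (Req_dec y 0) as [-> | Hy].
- assert (Hx : x <> 0) by (intros ->; now apply H0).
  assert (H := class_T_sign_real f x HT Hz Hx). rewrite Hf in H.
  replace (Re (q * (x, 0%R))%C) with (Re q * x) in H by (unfold Re; simpl; ring).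
  assert (H2 := Rmult_le_pos (- Re q) (x ^ 2) ltac:(lra) (pow2_ge_0 x)). lra.
- assert (H := class_T_sign f (x, y) HT Hz Hy). rewrite Hf in H.
  replace (Im (q * (x, y))%C) with (Re q * y + Im q * x) in H by (unfold Re, Im; simpl; ring).
  rewrite Hqi in H. change (Im (x, y)) with y in H.
  assert (H2 := Rmult_le_pos (- Re q) (y ^ 2) ltac:(lra) (pow2_ge_0 y)). lra.
Qed.

Lemma Cexp_circle r t : 0 < r -> Cexp (ln r, t) = circle_point r t.
Proof. intros Hr. unfold Cexp, circle_point; simpl. now rewrite exp_ln. Qed.

Lemma Cmod_circle r t : 0 <= r -> Cmod (circle_point r t) = r.
Proof.
intros [Hr | <-].
- rewrite <- Cexp_circle, Cmod_Cexp by trivial. now apply exp_ln.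
- unfold circle_point. rewrite !Rmult_0_l. apply Cmod_0.
Qed.

Lemma continuous_circle (g : C -> R) (f : C -> C) (r t : R) :
  (forall a b, Rabs (g a - g b) <= Cmod (a - b)) ->
  holomorphic_on_disk f -> 0 <= r < 1 ->
  continuous (fun s => g (f (circle_point r s))) t.
Proof.
intros Hg Hf Hr.
apply (continuous_along_curve g f (fun s => r * cos s) (fun s => r * sin s)); trivial.
- change (in_disk (circle_point r t)). unfold in_disk. rewrite Cmod_circle; lra.
- apply (continuous_mult (K := R_AbsRing) (fun _ => r)); [apply continuous_const|apply continuous_cos].
- apply (continuous_mult (K := R_AbsRing) (fun _ => r)); [apply continuous_const|apply continuous_sin].
Qed.

(** On the slit plane [|arg| < pi], so that for [p < 1/2] the power [H = (f z / z) ^ p] satisfies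
    [Re H >= cos (p pi) |H|] with [cos (p pi) > 0], and the integral of [Re H] over a circle does
    not depend on the radius. *)
Lemma class_T_hardy p f : 0 < p < 1 / 2 -> class_T f -> hardy p f.
Proof.
intros Hp HT. assert (Hhol := proj1 HT). split; trivial.
assert (HPI := PI_RGT_0).
pose (G z := (f z / z)%C).
pose (F w := Cexp (RtoC p * Clog (G (Cexp w)))%C).
assert (Hdisk : forall w, Re w < 0 -> in_disk (Cexp w)).
{ intros w Hw. unfold in_disk. rewrite Cmod_Cexp, <- exp_0. now apply exp_increasing. }
assert (HGs : forall w, Re w < 0 -> slit_plane (G (Cexp w))).
{ intros w Hw. apply class_T_quotient_slit; auto. apply Cexp_neq_0. }
assert (HF : forall w, Re w < 0 -> exists l, is_Cderive F w l).
{ intros w Hw. destruct (holomorphic_is_Cderive f _ Hhol (Hdisk w Hw)) as [l Hl].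
  eexists. unfold F.
  apply (is_Cderive_comp Cexp (fun w => RtoC p * Clog (G (Cexp w)))%C); [apply is_Cderive_Cexp|].
  apply is_Cderive_mult; [apply is_Cderive_const|].
  apply (is_Cderive_comp Clog (fun w => G (Cexp w))); [now apply is_Cderive_Clog, HGs|].
  apply (is_Cderive_comp G Cexp); [|apply is_Cderive_Cexp].
  apply is_Cderive_mult; [exact Hl|].
  apply is_Cderive_inv; [apply is_Cderive_id|apply Cexp_neq_0]. }
assert (Hper : forall x y, F (x, y + 2 * PI) = F (x, y)).
{ intros x y. unfold F. replace (Cexp (x, y + 2 * PI)) with (Cexp (x, y)); trivial.
  unfold Cexp; simpl. rewrite cos_plus, sin_plus, cos_2PI, sin_2PI. f_equal; ring. }
assert (HReF : forall w, Re (F w) = exp (p * ln (Cmod (G (Cexp w)))) * cos (p * Im (Clog (G (Cexp w))))).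
{ intros w. unfold F, Cexp at 1. simpl. f_equal; f_equal; unfold Im; simpl; ring. }
pose (k := cos (p * PI)).
assert (Hk : 0 < k) by (apply cos_gt_0; nra).
assert (Hcos : forall z, k <= cos (p * Im (Clog z))).
{ intros z. assert (Hb := Clog_bound z). unfold k. set (a := Im (Clog z)) in *.
  replace (cos (p * a)) with (cos (Rabs (p * a)))
    by (unfold Rabs; destruct (Rcase_abs (p * a)); [apply cos_neg|trivial]).
  assert (Habs : Rabs (p * a) <= p * PI).
  { rewrite Rabs_mult, (Rabs_pos_eq p) by lra. apply Rmult_le_compat_l; [lra|].
    apply Rabs_le. lra. }
  generalize (Rabs_pos (p * a)); intros. apply cos_decr_1; nra. }
(* [f z / z] tends to 1 at the origin, so that its modulus is at most 2 on small
   circles; this bounds the constant value of the means. *)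
assert (Hinit : exists x1, forall x y, x <= x1 -> Re (F (x, y)) <= 2).
{ destruct HT as [_ [H0 [H1 _]]].
  destruct (proj1 (is_Cderive_eps f 0%C 1%C) H1 1 Rlt_0_1) as [d [Hd H]].
  exists (Rmin (ln (d / 2)) (-1)). intros x y Hx.
  assert (Hx0 := Rle_trans _ _ _ Hx (Rmin_r _ _)).
  assert (Hx1 := Rle_trans _ _ _ Hx (Rmin_l _ _)).
  set (z := Cexp (x, y)).
  assert (Hz0 : z <> 0%C) by apply Cexp_neq_0.
  assert (Hz : Cmod z < d).
  { unfold z. rewrite Cmod_Cexp. simpl. apply Rle_lt_trans with (d / 2); [|lra].
    rewrite <- (exp_ln (d / 2)) by lra. destruct Hx1 as [Hx1 | ->]; [|lra].
    now apply Rlt_le, exp_increasing. }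
  specialize (H z). rewrite H0 in H.
  replace (z - 0)%C with z in H by ring. specialize (H Hz).
  replace (f z - 0 - z * 1)%C with (f z - z)%C in H by ring.
  assert (HG2 : Cmod (G z) <= 2).
  { unfold G. rewrite Cmod_div by trivial. apply Rle_div_l; [now apply Cmod_gt_0|].
    assert (T := Cmod_triangle (f z - z) z). replace (f z - z + z)%C with (f z) in T by ring. lra. }
  apply Rle_trans with (Cmod (F (x, y))); [apply (Rle_trans _ _ _ (Rle_abs _) (re_le_Cmod _))|].
  unfold F. fold z. rewrite Cmod_Cexp.
  replace (Re (RtoC p * Clog (G z))%C) with (p * ln (Cmod (G z))) by (simpl; ring).
  rewrite <- (exp_ln 2) by lra.
  assert (Hs : slit_plane (G z)) by (apply HGs; simpl; lra). apply slit_Cmod in Hs.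
  assert (Hln2 : 0 < ln 2) by (rewrite <- ln_1; apply ln_increasing; lra).
  assert (Hln : ln (Cmod (G z)) <= ln 2) by now apply ln_le.
  assert (Hfin : p * ln (Cmod (G z)) <= ln 2).
  { apply Rle_trans with (p * ln 2); [apply Rmult_le_compat_l|]; nra. }
  destruct Hfin as [Hfin | ->]; [|lra]. now apply Rlt_le, exp_increasing. }
destruct Hinit as [x1 Hx1].
assert (HintF : forall x, x < 0 -> ex_RInt (fun y => Re (F (x, y))) 0 (2 * PI)).
{ intros x Hx. apply (ex_RInt_continuous (V := R_CompleteNormedModule)). intros y _.
  destruct (HF (x, y) Hx) as [l Hl].
  apply (continuity_2d_slices (fun u v => Re (F (u, v))) x y), differentiable_continuity_pt.
  exists (Re l), (- Im l). now apply is_Cderive_half_CR. }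
assert (Hmean : forall x, x < 0 -> RInt (fun y => Re (F (x, y))) 0 (2 * PI) <= 4 * PI).
{ intros x Hx. rewrite <- (vertical_mean_invariant F (Rmin x x1) x HF Hper).
  2:{ split; [apply Rmin_l|trivial]. }
  assert (Hm := Rmin_l x x1).
  apply Rle_trans with (RInt (fun _ => 2) 0 (2 * PI)).
  - apply RInt_le; [lra|apply HintF; lra|apply ex_RInt_const|].
    intros y _. apply Hx1, Rmin_r.
  - rewrite RInt_const. unfold scal; simpl; unfold mult; simpl. lra. }
exists (4 * PI / k). intros r [[Hr0 | <-] Hr1].
- assert (Hln : ln r < 0) by (rewrite <- ln_1; now apply ln_increasing).
  (* [|f z|] is bounded by [|f z / z|] because [r < 1]. *)
  assert (Hpt : forall t, 0 < Cmod (f (circle_point r t)) /\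
    Cmod (G (circle_point r t)) = Cmod (f (circle_point r t)) / r).
  { intros t. assert (Hs := HGs (ln r, t) Hln). rewrite Cexp_circle in Hs by trivial.
    apply slit_Cmod in Hs.
    assert (Hz : circle_point r t <> 0%C) by (apply Cmod_gt_0; rewrite Cmod_circle; lra).
    unfold G in *. rewrite Cmod_div, Cmod_circle in * by (trivial; lra). split; trivial.
    replace (Cmod (f (circle_point r t))) with (Cmod (f (circle_point r t)) / r * r) by (field; lra).
    now apply Rmult_lt_0_compat. }
  rewrite (RInt_ext _ (fun t => exp (p * ln (Cmod (f (circle_point r t)))))).
  2:{ intros t _. unfold rpow. destruct (Req_EM_T _ _) as [E|_]; trivial.
      generalize (proj1 (Hpt t)). lra. }
  apply Rle_trans with (RInt (fun y => / k * Re (F (ln r, y))) 0 (2 * PI)).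
  + apply RInt_le; [lra| | |].
    * apply (ex_RInt_continuous (V := R_CompleteNormedModule)). intros t _.
      apply (continuous_comp (fun t => p * ln (Cmod (f (circle_point r t)))) exp);
        [|apply continuous_exp].
      apply (continuous_mult (K := R_AbsRing) (fun _ => p)); [apply continuous_const|].
      apply (continuous_comp (fun t => Cmod (f (circle_point r t))) ln).
      -- apply continuous_circle; trivial; [|lra]. intros a b. apply Cmod_minus_le.
      -- apply continuous_ln, Hpt.
    * apply (ex_RInt_scal (V := R_NormedModule) (fun y => Re (F (ln r, y))) 0 (2 * PI) (/ k)).
      now apply HintF.
    * intros t _. rewrite HReF, Cexp_circle by trivial.
      destruct (Hpt t) as [Hf HG]. rewrite HG.
      specialize (Hcos (G (circle_point r t))).
      set (m := Cmod (f (circle_point r t))) in *.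
      assert (Hexp : exp (p * ln m) <= exp (p * ln (m / r))).
      { rewrite ln_div by trivial.
        destruct (Req_dec (p * ln m) (p * (ln m - ln r))) as [<-|Hne]; [lra|].
        apply Rlt_le, exp_increasing. nra. }
      apply Rmult_le_reg_l with k; trivial. rewrite <- Rmult_assoc, Rinv_r, Rmult_1_l by lra.
      generalize (exp_pos (p * ln m)). nra.
  + replace (RInt _ 0 (2 * PI)) with (/ k * RInt (fun y => Re (F (ln r, y))) 0 (2 * PI)).
    2:{ symmetry. apply (RInt_scal (V := R_CompleteNormedModule) (fun y => Re (F (ln r, y)))).
        now apply HintF. }
    unfold Rdiv. rewrite Rmult_comm. apply Rmult_le_compat_r; [|now apply Hmean].
    now apply Rlt_le, Rinv_0_lt_compat.
- rewrite (RInt_ext _ (fun _ => 0)).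
  + rewrite RInt_const. unfold scal; simpl; unfold mult; simpl.
    rewrite Rmult_0_r. apply Rlt_le, Rdiv_lt_0_compat; lra.
  + intros t _. unfold circle_point. rewrite !Rmult_0_l.
    destruct HT as [_ [H0 _]]. change (0, 0) with (RtoC 0). rewrite H0.
    unfold rpow. destruct (Req_EM_T _ _) as [_|E]; trivial. now rewrite Cmod_0 in E.
Qed.

(** * Power series of rational functions *)

Lemma contracting_recursion (d e : nat -> R) (k : R) :
  0 <= k < 1 -> (forall n, 0 <= d n) -> (forall n, d (S n) <= e (S n) + k * d n) ->
  (forall eps, 0 < eps -> exists N, forall n, (N <= n)%nat -> e n < eps) ->
  forall eps, 0 < eps -> exists N, forall n, (N <= n)%nat -> d n < eps.
Proof.
intros Hk Hd Hrec He eps Heps.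
destruct (He (eps / 2 * (1 - k))) as [N HN]; [apply Rmult_lt_0_compat; lra|].
assert (Hm : forall m, d (m + N)%nat <= eps / 2 + k ^ m * d N).
{ induction m as [|m IH]; simpl.
  - lra.
  - specialize (Hrec (m + N)%nat). specialize (HN (S (m + N)) ltac:(lia)).
    assert (k * d (m + N)%nat <= k * (eps / 2 + k ^ m * d N)) by (apply Rmult_le_compat_l; lra).
    lra. }
destruct (pow_lt_1_zero k) with (y := eps / 2 / (1 + d N)) as [P HP].
{ rewrite Rabs_pos_eq; lra. }
{ specialize (Hd N). apply Rdiv_lt_0_compat; lra. }
exists (P + N)%nat. intros n Hn. specialize (Hm (n - N)%nat).
replace (n - N + N)%nat with n in Hm by lia.
specialize (HP (n - N)%nat ltac:(lia)). specialize (Hd N).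
assert (Hp := pow_le k (n - N) (proj1 Hk)).
rewrite Rabs_pos_eq in HP by trivial.
apply Rmult_lt_compat_r with (r := 1 + d N) in HP; [|lra].
replace (eps / 2 / (1 + d N) * (1 + d N)) with (eps / 2) in HP by (field; lra).
nra.
Qed.

Definition Csum (s : nat -> C) (n : nat) : C := sum_n (G := C_AbelianMonoid) s n.

Lemma Csum_O (s : nat -> C) : Csum s 0 = s 0%nat.
Proof. exact (sum_O (G := C_AbelianMonoid) s). Qed.

Lemma Csum_S (s : nat -> C) n : Csum s (S n) = (Csum s n + s (S n))%C.
Proof. exact (sum_Sn (G := C_AbelianMonoid) s n). Qed.

Lemma is_Cseries_eps (s : nat -> C) (l : C) :
  is_series (K := C_AbsRing) (V := C_NormedModule) s l <->
  forall eps, 0 < eps -> exists N, forall n, (N <= n)%nat ->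
    Cmod (Csum s n - l) < eps.
Proof.
assert (B := filterlim_locally_ball_norm (K := C_AbsRing) (U := C_NormedModule)
  (F := eventually) (sum_n (G := C_AbelianMonoid) s) l).
split.
- intros H eps Heps. exact (proj1 B H (mkposreal eps Heps)).
- intros H. apply (proj2 B). intros [eps Heps]. exact (H eps Heps).
Qed.

(** Multiplication of a power series by the geometric series of [rho = q z]. The partial sums
    satisfy [U_(n+1) = S_(n+1) + rho U_n], and so does the claimed limit, so that the
    errors obey a recursion contracting by the factor [|rho|]. *)
Lemma is_series_div_linear (s u : nat -> C) (rho l : C) :
  Cmod rho < 1 -> u 0%nat = s 0%nat -> (forall n, u (S n) = s (S n) + rho * u n)%C ->
  is_series (K := C_AbsRing) (V := C_NormedModule) s l ->
  is_series (K := C_AbsRing) (V := C_NormedModule) u (l / (1 - rho))%C.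
Proof.
intros Hrho Hu0 Hu Hs. rewrite is_Cseries_eps in *.
assert (Hne : (1 - rho)%C <> 0%C).
{ intros E. assert (rho = 1%C) as ->.
  { replace rho with (1 - (1 - rho))%C by ring. rewrite E. ring. }
  rewrite Cmod_1 in Hrho. lra. }
assert (Hsum : forall n, Csum u (S n) =
   (Csum s (S n) + rho * Csum u n)%C).
{ induction n as [|n IH].
  - rewrite !Csum_S, !Csum_O, Hu, Hu0. ring.
  - assert (Es : Csum s (S n) = (Csum u (S n) - rho * Csum u n)%C) by (rewrite IH; ring).
    rewrite (Csum_S u (S n)), (Csum_S s (S n)), Es, (Csum_S u n), (Hu (S n)). ring. }
apply (contracting_recursion _ (fun n => Cmod (Csum s n - l)) (Cmod rho)).
- split; [apply Cmod_ge_0|trivial].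
- intros n. apply Cmod_ge_0.
- intros n. rewrite Hsum.
  replace (_ - l / (1 - rho))%C with ((Csum s (S n) - l)
     + rho * (Csum u n - l / (1 - rho)))%C by (field; trivial).
  rewrite <- Cmod_mult. apply Cmod_triangle.
- exact Hs.
Qed.

(** The first three coefficients are recorded, to keep track of [a 2] through the
    construction of a rational function from sums, shifts and geometric
    factors. *)
Definition real_expansion (f : C -> C) (a0 a1 a2 : R) : Prop :=
  exists a : nat -> R, a 0%nat = a0 /\ a 1%nat = a1 /\ a 2%nat = a2 /\
    forall z, in_disk z ->
      is_pseries (K := C_AbsRing) (V := C_NormedModule) (fun n => RtoC (a n)) z (f z).

Lemma real_expansion_ext f g a0 a1 a2 :
  (forall z, in_disk z -> f z = g z) -> real_expansion f a0 a1 a2 -> real_expansion g a0 a1 a2.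
Proof.
intros H [a [H0 [H1 [H2 Ha]]]]. exists a. repeat split; trivial.
intros z Hz. rewrite <- H; auto.
Qed.

Lemma real_expansion_one : real_expansion (fun _ => 1%C) 1 0 0.
Proof.
exists (fun n => match n with O => 1 | _ => 0 end). repeat split; trivial.
intros z _. unfold is_pseries. apply is_Cseries_eps. intros eps Heps. exists 0%nat. intros n _.
replace (Csum _ n) with (RtoC 1).
- replace (1 - 1)%C with (RtoC 0) by ring. rewrite Cmod_0. trivial.
- induction n as [|n IH].
  + rewrite Csum_O. unfold scal; simpl; unfold mult, one; simpl. ring.
  + rewrite Csum_S, <- IH. unfold scal; simpl; unfold mult; simpl. ring.
Qed.

Lemma real_expansion_plus f g a0 a1 a2 b0 b1 b2 :
  real_expansion f a0 a1 a2 -> real_expansion g b0 b1 b2 ->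
  real_expansion (fun z => f z + g z)%C (a0 + b0) (a1 + b1) (a2 + b2).
Proof.
intros [a [<- [<- [<- Ha]]]] [b [<- [<- [<- Hb]]]].
exists (fun n => a n + b n). repeat split. intros z Hz.
eapply is_pseries_ext; [|apply (is_pseries_plus _ _ _ _ _ (Ha z Hz) (Hb z Hz))].
intros n. symmetry. apply RtoC_plus.
Qed.

Lemma real_expansion_scal f a0 a1 a2 k :
  real_expansion f a0 a1 a2 ->
  real_expansion (fun z => RtoC k * f z)%C (k * a0) (k * a1) (k * a2).
Proof.
intros [a [<- [<- [<- Ha]]]].
exists (fun n => k * a n). repeat split. intros z Hz.
eapply is_pseries_ext; [|apply (is_pseries_scal (RtoC k) _ _ _ (Cmult_comm _ _) (Ha z Hz))].
intros n. symmetry. apply RtoC_mult.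
Qed.

Lemma real_expansion_shift f a0 a1 a2 :
  real_expansion f a0 a1 a2 -> real_expansion (fun z => z * f z)%C 0 a0 a1.
Proof.
intros [a [<- [<- [<- Ha]]]].
exists (fun n => match n with O => 0 | S m => a m end). repeat split. intros z Hz.
eapply is_pseries_ext; [|apply (is_pseries_incr_1 _ _ _ (Ha z Hz))].
intros [|n]; reflexivity.
Qed.

Lemma real_expansion_div_linear f a0 a1 a2 q :
  Rabs q <= 1 -> real_expansion f a0 a1 a2 ->
  real_expansion (fun z => f z / (1 - RtoC q * z))%C
    a0 (a1 + q * a0) (a2 + q * (a1 + q * a0)).
Proof.
intros Hq [a [<- [<- [<- Ha]]]].
pose (b := fix b n := match n with O => a 0%nat | S m => a (S m) + q * b m end).
exists b. repeat split. intros z Hz. unfold is_pseries in *.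
apply (is_series_div_linear _ _ _ _) with (4 := Ha z Hz).
- rewrite Cmod_mult, Cmod_R. unfold in_disk in Hz. generalize (Cmod_ge_0 z) (Rabs_pos q). nra.
- reflexivity.
- intros n. unfold scal; simpl. unfold mult; simpl. rewrite RtoC_plus, RtoC_mult. ring.
Qed.

(** * A univalent function with a double pole *)

(** The arguments of two points of the right half-plane add up to less than [pi] in
    modulus, so that their product is not a negative real number. *)
Lemma half_plane_product (a b : C) (k : R) :
  0 < Re a -> 0 < Re b -> 0 <= k -> (a * b + RtoC k)%C <> 0%C.
Proof.
intros Ha Hb Hk E. destruct a as [a1 a2], b as [b1 b2].
apply (f_equal Re) in E as E1. apply (f_equal Im) in E as E2. clear E.
unfold Re, Im in *; simpl in *.
(* The real part of [(a b + k)] times the conjugate of [b]. *)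
assert (a1 * (b1 ^ 2 + b2 ^ 2) + k * b1 = 0).
{ transitivity ((a1 * b1 - a2 * b2 + k) * b1 + (a1 * b2 + a2 * b1 + 0) * b2); [ring|].
  rewrite E1, E2. ring. }
assert (0 < a1 * (b1 ^ 2 + b2 ^ 2)) by (apply Rmult_lt_0_compat; nra).
nra.
Qed.

Lemma disk_coordinates (z : C) : in_disk z -> Re z ^ 2 + Im z ^ 2 < 1.
Proof.
unfold in_disk. intros H. rewrite <- Cmod2_alt. generalize (Cmod_ge_0 z). nra.
Qed.

(** Up to a positive factor, the real part of [(1 + c z) / (1 - z)]. It is affine in [c],
    and is [1 - |z|^2] for [c = 1] and [|1 - z|^2] for [c = -1]. *)
Lemma moebius_numerator_pos (c x y : R) :
  -1 <= c <= 1 -> x ^ 2 + y ^ 2 < 1 -> 0 < (1 + c * x) * (1 - x) - c * y ^ 2.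
Proof. intros Hc Hxy.
assert (H1 : 0 < 1 - (x ^ 2 + y ^ 2)) by lra.
assert (H2 : 0 < (1 - x) ^ 2 + y ^ 2) by nra.
replace ((1 + c * x) * (1 - x) - c * y ^ 2) with
  ((1 + c) / 2 * (1 - (x ^ 2 + y ^ 2)) + (1 - c) / 2 * ((1 - x) ^ 2 + y ^ 2)) by field.
destruct (Rle_dec 0 c); nra.
Qed.

Lemma Re_div (a b : C) : b <> 0%C -> Re (a / b)%C = (Re a * Re b + Im a * Im b) / Cmod b ^ 2.
Proof.
intros Hb. rewrite Cmod2_alt.
assert (H : Cmod b ^ 2 <> 0) by (apply pow_nonzero, Rgt_not_eq; now apply Cmod_gt_0).
rewrite Cmod2_alt in H. destruct a as [a1 a2], b as [b1 b2]. unfold Re, Im in *; simpl in *.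
field. simpl in H. lra.
Qed.

Lemma Re_div_pos (a b : C) : b <> 0%C -> 0 < Re a * Re b + Im a * Im b -> 0 < Re (a / b)%C.
Proof.
intros Hb H. rewrite Re_div by trivial. apply Rdiv_lt_0_compat; trivial.
apply pow_lt. now apply Cmod_gt_0.
Qed.

Lemma one_plus_neq_0 (c : R) (z : C) : -1 <= c <= 1 -> in_disk z -> (1 + RtoC c * z)%C <> 0%C.
Proof.
intros Hc Hz E. unfold in_disk in Hz.
assert (H : (RtoC c * z)%C = (- (1))%C).
{ replace (RtoC c * z)%C with (1 + RtoC c * z - 1)%C by ring. rewrite E. ring. }
apply (f_equal Cmod) in H. rewrite Cmod_mult, Cmod_R, Cmod_m1 in H.
assert (Rabs c <= 1) by (apply Rabs_le; lra).
generalize (Cmod_ge_0 z) (Rabs_pos c). nra.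
Qed.

Lemma one_minus_neq_0 (z : C) : in_disk z -> (1 - z)%C <> 0%C.
Proof.
intros Hz. replace (1 - z)%C with (1 + RtoC (-1) * z)%C.
apply one_plus_neq_0; trivial; lra.
apply injective_projections; simpl; ring.
Qed.

(** The univalent map [Y] into the half-plane [Re w > - 1 / (2 e)] with a simple pole at 1. The
    weight [1/4] at the pole is small enough for the second coefficient
    [1/4 - 3/4 (1 - 2 e)] to become negative for small [e]. *)
Definition half_plane_map (e : R) (z : C) : C :=
  (RtoC (1 / 4) * (z / (1 - z)) + RtoC (3 / 4) * (z / (1 + RtoC (1 - 2 * e) * z)))%C.

(** With [u = 1 + 2 e Y], of positive real part, [f = Y + e Y^2] is [(u^2 - 1) / (4 e)]: squaring is
    injective on the right half-plane and doubles the order of the pole. *)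
Definition squared_map (e : R) (z : C) : C := (half_plane_map e z + RtoC e * (half_plane_map e z * half_plane_map e z))%C.

(** With [A v = (1 + c v) / (1 - v)], the difference [Y z - Y w] is a nonzero multiple of
    [(z - w) * (A z * A w + 3)], and [A] maps the disk into the right half-plane. *)
Lemma half_plane_map_injective e z w : 0 < e <= 1 -> in_disk z -> in_disk w ->
  half_plane_map e z = half_plane_map e w -> z = w.
Proof.
intros He Hz Hw E. set (c := 1 - 2 * e).
assert (Hc : -1 <= c <= 1) by (unfold c; lra).
assert (Z1 := one_minus_neq_0 z Hz). assert (W1 := one_minus_neq_0 w Hw).
assert (Z2 := one_plus_neq_0 c z Hc Hz). assert (W2 := one_plus_neq_0 c w Hc Hw).
assert (Hpos : forall v, in_disk v -> 0 < Re ((1 + RtoC c * v) / (1 - v))%C).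
{ intros v Hv. apply Re_div_pos; [now apply one_minus_neq_0|].
  apply disk_coordinates in Hv.
  assert (H := moebius_numerator_pos c (Re v) (Im v) Hc Hv).
  replace (_ + _) with ((1 + c * Re v) * (1 - Re v) - c * Im v ^ 2); trivial.
  unfold Re, Im; simpl; ring. }
assert (Hprod := half_plane_product _ _ 3 (Hpos z Hz) (Hpos w Hw) ltac:(lra)).
assert (Hzero : ((z - w) * ((1 + RtoC c * z) / (1 - z) * ((1 + RtoC c * w) / (1 - w)) + RtoC 3) = 0)%C).
{ assert (E0 : (half_plane_map e z - half_plane_map e w = 0)%C) by (rewrite E; ring).
  transitivity ((half_plane_map e z - half_plane_map e w) * (RtoC 4 * (1 + RtoC c * z) * (1 + RtoC c * w)))%C.
  - unfold half_plane_map. fold c.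
    replace (RtoC (1 / 4)) with (/ RtoC 4)%C by (rewrite <- RtoC_inv; f_equal; lra).
    replace (RtoC (3 / 4)) with (RtoC 3 / RtoC 4)%C by (rewrite <- RtoC_div; f_equal; lra).
    field. now repeat split.
  - rewrite E0. ring. }
assert (Hd : (z - w = 0)%C).
{ apply Classical_Prop.NNPP. intros Hne. now apply (Cmult_neq_0 _ _ Hne Hprod). }
replace z with (z - w + w)%C by ring. rewrite Hd. ring.
Qed.

(** Both summands of [Y] map the disk into half-planes:
    [z / (1 - z) + 1/2] is half of [(1 + z) / (1 - z)], and because [2 e + c = 1],
    [z / (1 + c z) + 1 / (2 e)] is a positive multiple of [(1 + z) / (1 + c z)].
    The resulting bound [- e / 8 - 3 / 8] is at least [- 1 / 2] since [e <= 1]. *)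
Lemma half_plane_map_range e z : 0 < e <= 1 -> in_disk z -> - / 2 < Re (RtoC e * half_plane_map e z)%C.
Proof.
intros He Hz. set (c := 1 - 2 * e).
assert (Hc : -1 <= c <= 1) by (unfold c; lra).
assert (Z1 := one_minus_neq_0 z Hz). assert (Z2 := one_plus_neq_0 c z Hc Hz).
assert (Hr := disk_coordinates z Hz).
assert (P1 : 0 < Re ((1 + z) / (1 - z))%C).
{ apply Re_div_pos; trivial. unfold Re, Im in *; simpl. nra. }
assert (P2 : 0 < Re ((1 + z) / (1 + RtoC c * z))%C).
{ apply Re_div_pos; trivial.
  assert (H := moebius_numerator_pos (- c) (- Re z) (- Im z) ltac:(lra) ltac:(lra)).
  unfold Re, Im in *; simpl. nra. }
assert (E : (RtoC e * half_plane_map e z = RtoC (e / 8) * ((1 + z) / (1 - z))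
   + RtoC (3 / 8) * ((1 + z) / (1 + RtoC c * z)) - RtoC (e / 8 + 3 / 8))%C).
{ assert (H2 : (RtoC 2 * RtoC e + RtoC c = 1)%C).
  { rewrite <- RtoC_mult, <- RtoC_plus. f_equal. unfold c. ring. }
  unfold half_plane_map. fold c.
  replace (RtoC (e / 8)) with (RtoC e / RtoC 8)%C by (rewrite <- RtoC_div; f_equal; lra).
  replace (RtoC (3 / 8)) with (RtoC 3 / RtoC 8)%C by (rewrite <- RtoC_div; f_equal; lra).
  replace (RtoC (1 / 4)) with (RtoC 2 / RtoC 8)%C by (rewrite <- RtoC_div; f_equal; lra).
  replace (RtoC (3 / 4)) with (RtoC 3 * RtoC 2 / RtoC 8)%C
    by (rewrite <- RtoC_mult, <- RtoC_div; f_equal; lra).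
  replace (RtoC (e / 8 + 3 / 8)) with (RtoC e / RtoC 8 + RtoC 3 / RtoC 8)%C
    by (rewrite <- !RtoC_div, <- RtoC_plus; f_equal; lra).
  replace (RtoC c) with (1 - RtoC 2 * RtoC e)%C in * by (rewrite <- H2; ring).
  assert (H8 : RtoC 8 <> 0%C) by (intros H; apply RtoC_inj in H; lra).
  field_simplify_eq; [|repeat split; trivial].
  replace (RtoC 2) with (1 + 1)%C by (apply injective_projections; simpl; ring).
  ring. }
rewrite E.
replace (Re _) with (e / 8 * Re ((1 + z) / (1 - z))%C
   + 3 / 8 * Re ((1 + z) / (1 + RtoC c * z))%C - (e / 8 + 3 / 8)).
- nra.
- generalize ((1 + z) / (1 - z))%C ((1 + z) / (1 + RtoC c * z))%C. intros a b.
  unfold Re; simpl. ring.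
Qed.

(** [f z - f w = (Y z - Y w) * (1 + e Y z + e Y w)], and the second factor has positive real
    part. *)
Lemma squared_map_injective e z w : 0 < e <= 1 -> in_disk z -> in_disk w ->
  squared_map e z = squared_map e w -> z = w.
Proof.
intros He Hz Hw E. apply (half_plane_map_injective e); trivial.
assert (Hz1 := half_plane_map_range e z He Hz). assert (Hw1 := half_plane_map_range e w He Hw).
apply Classical_Prop.NNPP. intros Hne.
assert (Hd : (half_plane_map e z - half_plane_map e w)%C <> 0%C).
{ intros H. apply Hne. replace (half_plane_map e z) with (half_plane_map e z - half_plane_map e w + half_plane_map e w)%C by ring.
  rewrite H. ring. }
assert (Hs : (1 + (RtoC e * half_plane_map e z + RtoC e * half_plane_map e w))%C <> 0%C).
{ intros H. apply (f_equal Re) in H.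
  replace (Re (1 + (RtoC e * half_plane_map e z + RtoC e * half_plane_map e w))%C)
    with (1 + (Re (RtoC e * half_plane_map e z)%C + Re (RtoC e * half_plane_map e w)%C)) in H by reflexivity.
  change (Re 0%C) with 0 in H. lra. }
apply (Cmult_neq_0 _ _ Hd Hs).
transitivity (squared_map e z - squared_map e w)%C; [unfold squared_map; ring|].
rewrite E. ring.
Qed.

Lemma squared_map_holomorphic e : 0 < e <= 1 -> holomorphic_on_disk (squared_map e).
Proof.
intros He z Hz.
assert (Z1 := one_minus_neq_0 z Hz).
assert (Z2 := one_plus_neq_0 (1 - 2 * e) z ltac:(lra) Hz).
assert (H1 : exists l, is_Cderive (fun z => z / (1 - z))%C z l).
{ eexists. apply is_Cderive_mult; [apply is_Cderive_id|].
  apply is_Cderive_inv; [|trivial].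
  apply (is_Cderive_plus (fun _ => 1%C) (fun z => - z)%C); [apply is_Cderive_const|].
  exact (is_derive_opp (K := C_AbsRing) (V := C_NormedModule) (fun z => z) z _ (is_Cderive_id z)). }
assert (H2 : exists l, is_Cderive (fun z => z / (1 + RtoC (1 - 2 * e) * z))%C z l).
{ eexists. apply is_Cderive_mult; [apply is_Cderive_id|].
  apply is_Cderive_inv; [|trivial].
  apply (is_Cderive_plus (fun _ => 1%C)); [apply is_Cderive_const|].
  apply (is_Cderive_mult (fun _ => RtoC (1 - 2 * e))); [apply is_Cderive_const|apply is_Cderive_id]. }
destruct H1 as [l1 H1]. destruct H2 as [l2 H2].
assert (H3 : exists l, is_Cderive (half_plane_map e) z l).
{ eexists. apply is_Cderive_plus.
  - apply (is_Cderive_mult (fun _ => RtoC (1 / 4))); [apply is_Cderive_const|exact H1].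
  - apply (is_Cderive_mult (fun _ => RtoC (3 / 4))); [apply is_Cderive_const|exact H2]. }
destruct H3 as [l3 H3].
eexists. apply (is_Cderive_plus (half_plane_map e)); [exact H3|].
apply (is_Cderive_mult (fun _ => RtoC e)); [apply is_Cderive_const|].
apply is_Cderive_mult; exact H3.
Qed.

(** The square [Y ^ 2] is expanded into its three products, and each of them is
    obtained from the constant 1 by two shifts and two geometric factors. *)
Lemma squared_map_expansion e : 0 < e <= 1 ->
  real_expansion (squared_map e) 0 1 (5 / 2 * e - 1 / 2).
Proof.
intros He. set (c := 1 - 2 * e).
assert (H1 : Rabs 1 <= 1) by (rewrite Rabs_R1; lra).
assert (Hc : Rabs (- c) <= 1) by (apply Rabs_le; unfold c; lra).
assert (A := real_expansion_shift _ _ _ _ (real_expansion_div_linear _ _ _ _ _ H1 real_expansion_one)).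
assert (B := real_expansion_shift _ _ _ _ (real_expansion_div_linear _ _ _ _ _ Hc real_expansion_one)).
assert (AA := real_expansion_shift _ _ _ _ (real_expansion_div_linear _ _ _ _ _ H1 A)).
assert (AB := real_expansion_shift _ _ _ _ (real_expansion_div_linear _ _ _ _ _ Hc A)).
assert (BB := real_expansion_shift _ _ _ _ (real_expansion_div_linear _ _ _ _ _ Hc B)).
assert (T := real_expansion_plus _ _ _ _ _ _ _ _
  (real_expansion_plus _ _ _ _ _ _ _ _
     (real_expansion_scal _ _ _ _ (1 / 4) A) (real_expansion_scal _ _ _ _ (3 / 4) B))
  (real_expansion_scal _ _ _ _ e
    (real_expansion_plus _ _ _ _ _ _ _ _ (real_expansion_scal _ _ _ _ (1 / 16) AA)
      (real_expansion_plus _ _ _ _ _ _ _ _ (real_expansion_scal _ _ _ _ (3 / 8) AB)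
         (real_expansion_scal _ _ _ _ (9 / 16) BB))))).
match type of T with real_expansion _ ?a0 ?a1 ?a2 =>
  replace a0 with 0 in T by ring; replace a1 with 1 in T by field;
  replace a2 with (5 / 2 * e - 1 / 2) in T by (unfold c; field) end.
revert T. apply real_expansion_ext. intros z Hz.
assert (Z1 := one_minus_neq_0 z Hz).
assert (Z2 := one_plus_neq_0 c z ltac:(unfold c; lra) Hz).
unfold squared_map, half_plane_map. fold c.
replace (RtoC (1 / 16)) with (RtoC (1 / 4) * RtoC (1 / 4))%C by (rewrite <- RtoC_mult; f_equal; lra).
replace (RtoC (9 / 16)) with (RtoC (3 / 4) * RtoC (3 / 4))%C by (rewrite <- RtoC_mult; f_equal; lra).
replace (RtoC (3 / 8)) with ((1 + 1) * (RtoC (1 / 4) * RtoC (3 / 4)))%C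
  by (apply injective_projections; simpl; field).
replace (1 - RtoC (- c) * z)%C with (1 + RtoC c * z)%C by (rewrite RtoC_opp; ring).
field. split; [trivial|]. now replace (1 - 1 * z)%C with (1 - z)%C by ring.
Qed.

(** [|Y| >= |z| / (4 |1 - z|)] because [(1 - z) / (1 + c z)] has positive real part, and
    [|1 + e Y| >= |e Y|] because [Re (e Y) > - 1/2]. Hence
    [|f| >= e |Y|^2 >= (|Y| / 3)^2]. *)
Lemma squared_map_growth e z : 1 / 9 <= e <= 1 -> in_disk z ->
  Cmod z / 12 / Cmod (1 - z) <= sqrt (Cmod (squared_map e z)).
Proof.
intros He Hz. set (c := 1 - 2 * e).
assert (Hc : -1 <= c <= 1) by (unfold c; lra).
assert (Z1 := one_minus_neq_0 z Hz). assert (Z2 := one_plus_neq_0 c z Hc Hz).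
assert (Hm := proj1 (Cmod_gt_0 _) Z1).
assert (Hcore : Cmod z / 4 / Cmod (1 - z) <= Cmod (half_plane_map e z)).
{ assert (P : 0 < Re ((1 - z) / (1 + RtoC c * z))%C).
  { apply Re_div_pos; trivial. assert (Hr := disk_coordinates z Hz).
    assert (H := moebius_numerator_pos c (Re z) (Im z) Hc Hr).
    unfold Re, Im in *; simpl. nra. }
  assert (E : half_plane_map e z = (z / (1 - z) * (RtoC (1 / 4) + RtoC (3 / 4) * ((1 - z) / (1 + RtoC c * z))))%C).
  { unfold half_plane_map. fold c. field. now split. }
  rewrite E, Cmod_mult, Cmod_div by trivial.
  replace (Cmod z / 4 / Cmod (1 - z)) with (Cmod z / Cmod (1 - z) * (1 / 4)) by (field; lra).
  apply Rmult_le_compat_l.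
  { apply Rdiv_le_0_compat; [apply Cmod_ge_0|trivial]. }
  eapply Rle_trans; [|eapply Rle_trans; [apply Rle_abs|apply re_le_Cmod]].
  revert P. generalize ((1 - z) / (1 + RtoC c * z))%C. intros a. unfold Re; simpl. intros. lra. }
assert (Hhalf := half_plane_map_range e z ltac:(lra) Hz).
assert (H1 : Cmod (RtoC e * half_plane_map e z) <= Cmod (1 + RtoC e * half_plane_map e z)).
{ revert Hhalf. generalize (RtoC e * half_plane_map e z)%C. intros [a b] H. simpl in H.
  unfold Cmod. apply sqrt_le_1_alt. simpl. nra. }
rewrite Cmod_mult, Cmod_R, Rabs_pos_eq in H1 by lra.
assert (H2 : Cmod (squared_map e z) = Cmod (half_plane_map e z) * Cmod (1 + RtoC e * half_plane_map e z)).
{ rewrite <- Cmod_mult. f_equal. unfold squared_map. ring. }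
assert (H0 := Cmod_ge_0 (half_plane_map e z)).
apply Rle_trans with (Cmod (half_plane_map e z) / 3).
{ replace (Cmod z / 12 / Cmod (1 - z)) with (Cmod z / 4 / Cmod (1 - z) / 3) by (field; lra). lra. }
rewrite <- (sqrt_Rsqr (Cmod (half_plane_map e z) / 3)) by lra.
apply sqrt_le_1_alt. rewrite H2. unfold Rsqr. nra.
Qed.

Lemma one_minus_cos_le t : 0 <= t -> 1 - cos t <= t ^ 2 / 2.
Proof.
intros Ht. replace t with (2 * (t / 2)) at 1 by field. rewrite cos_2a_sin.
set (s := t / 2). replace (t ^ 2 / 2) with (2 * s ^ 2) by (unfold s; field).
assert (Hs : 0 <= s) by (unfold s; lra).
enough (sin s * sin s <= s ^ 2) by lra.
destruct (Rle_dec 1 s) as [H|H].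
- generalize (sin2_cos2 s) (Rle_0_sqr (cos s)). unfold Rsqr. nra.
- assert (0 <= sin s) by (apply sin_ge_0; generalize PI2_3_2; unfold PI2; lra).
  destruct Hs as [Hs| <-]; [|rewrite sin_0; lra].
  assert (H1 := sin_lt_x s Hs). nra.
Qed.

Lemma Cmod_one_minus_circle r t : 0 <= r <= 1 -> 0 <= t ->
  Cmod (1 - circle_point r t) <= 1 - r + t.
Proof.
intros Hr Ht. apply Rsqr_incr_0_var; [|lra].
assert (H := Cmod2_alt (1 - circle_point r t)). rewrite Rsqr_pow2, H.
unfold Re, Im; simpl. assert (Hc := one_minus_cos_le t Ht).
assert (H2 := sin2_cos2 t). unfold Rsqr in *.
replace ((1 + - (r * cos t)) * ((1 + - (r * cos t)) * 1) + (0 + - (r * sin t)) * ((0 + - (r * sin t)) * 1))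
  with (1 - 2 * r * cos t + r * r * (sin t * sin t + cos t * cos t)) by ring.
rewrite H2. nra.
Qed.

Lemma RInt_inv_shift (a b : R) : 0 < a -> 0 <= b ->
  is_RInt (fun t => / (a + t)) 0 b (ln (a + b) - ln a).
Proof.
intros Ha Hb.
replace (ln (a + b) - ln a) with (ln (a + b) - ln (a + 0)) by (f_equal; f_equal; ring).
apply (is_RInt_derive (V := R_CompleteNormedModule) (fun t => ln (a + t)) (fun t => / (a + t))).
- rewrite Rmin_left, Rmax_right by lra. intros t Ht. auto_derive; [lra|field; lra].
- rewrite Rmin_left, Rmax_right by lra. intros t Ht.
  apply (continuous_comp (fun t => a + t) Rinv).
  + apply (continuous_plus (V := R_NormedModule) (fun _ => a)); [apply continuous_const|apply continuous_id].
  + apply continuous_Rinv. lra.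
Qed.

(** On the circle of radius [r = 1 - a] the integrand is at least a multiple of [1 / (a + t)],
    whose integral over [[0, 2 pi]] exceeds [- ln a]; [a] is then chosen according
    to the supposed bound. *)
Lemma squared_map_not_hardy e : 1 / 9 <= e <= 1 -> ~ hardy (1 / 2) (squared_map e).
Proof.
intros He [Hhol [M HM]].
assert (HPI := PI_RGT_0).
(* With [r >= 1/2] the growth bound is at least [1 / (24 (a + t))]. *)
pose (K := 24 * (Rabs M + 1)).
assert (HK : 24 <= K) by (unfold K; generalize (Rabs_pos M); lra).
pose (a := exp (- K)).
assert (Ha : 0 < a) by apply exp_pos.
assert (Ha2 : a <= 1 / 2).
{ unfold a. rewrite exp_Ropp. rewrite <- (Rinv_inv (1 / 2)). apply Rinv_le_contravar; [lra|].
  generalize (exp_ineq1_le K). lra. }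
pose (r := 1 - a). assert (Hr : 1 / 2 <= r < 1) by (unfold r; lra).
specialize (HM r ltac:(lra)).
rewrite (RInt_ext _ (fun t => sqrt (Cmod (squared_map e (circle_point r t))))) in HM.
2:{ intros t _. unfold rpow. generalize (Cmod_ge_0 (squared_map e (circle_point r t))).
    destruct (Req_EM_T _ _) as [-> | Hne]; intros H0; [now rewrite sqrt_0|].
    replace (1 / 2) with (/ 2) by field. apply Rpower_sqrt. lra. }
assert (Hlow : RInt (fun t => 1 / 24 * / (a + t)) 0 (2 * PI)
   <= RInt (fun t => sqrt (Cmod (squared_map e (circle_point r t)))) 0 (2 * PI)).
{ apply RInt_le; [lra| | |].
  - apply (ex_RInt_scal (V := R_NormedModule) (fun t => / (a + t)) 0 (2 * PI) (1 / 24)).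
    eexists. apply RInt_inv_shift; lra.
  - apply (ex_RInt_continuous (V := R_CompleteNormedModule)). intros t _.
    apply (continuous_comp (fun t => Cmod (squared_map e (circle_point r t))) sqrt).
    + apply continuous_circle; trivial; [|lra]. intros u v. apply Cmod_minus_le.
    + apply continuous_sqrt.
  - intros t Ht.
    assert (Hz : in_disk (circle_point r t)) by (unfold in_disk; rewrite Cmod_circle; lra).
    eapply Rle_trans; [|apply (squared_map_growth e _ He Hz)].
    rewrite Cmod_circle by lra.
    assert (Hm := proj1 (Cmod_gt_0 _) (one_minus_neq_0 _ Hz)).
    assert (Hd := Cmod_one_minus_circle r t ltac:(lra) ltac:(lra)).
    replace (1 - r + t) with (a + t) in Hd by (unfold r; ring).
    unfold Rdiv. apply Rmult_le_compat; try lra.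
    + apply Rlt_le, Rinv_0_lt_compat; lra.
    + now apply Rinv_le_contravar. }
rewrite (RInt_scal (V := R_CompleteNormedModule) (fun t => / (a + t))) in Hlow
  by (eexists; apply RInt_inv_shift; lra).
rewrite (is_RInt_unique _ _ _ _ (RInt_inv_shift a (2 * PI) Ha ltac:(lra))) in Hlow.
unfold scal in Hlow; simpl in Hlow; unfold mult in Hlow; simpl in Hlow.
assert (Hlna : ln a = - K) by (unfold a; apply ln_exp).
assert (0 < ln (a + 2 * PI)).
{ rewrite <- ln_1. apply ln_increasing; [lra|]. generalize PI2_3_2; unfold PI2; lra. }
assert (HMabs := Rle_abs M). unfold K in Hlna. lra.
Qed.

(** * Hardy classes of T and of S_R *)

Theorem theorem10 :
  (forall p : R, 0 < p < 1 / 2 ->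
     forall f : C -> C, class_T f -> hardy p f) /\
  (forall alpha : R, 0 <= alpha <= 2 ->
     exists (f : C -> C) (a : nat -> C),
       class_SR f /\ normalized_expansion f a /\
       a 2%nat = RtoC alpha /\ ~ hardy (1 / 2) f).
Proof.
split.
- intros p Hp f Hf. now apply class_T_hardy.
- intros alpha Halpha.
  (* The solution of [5 / 2 * e - 1 / 2 = alpha]; it lies in [[1/5, 1]]. *)
  set (e := (2 * alpha + 1) / 5).
  assert (He : 1 / 9 <= e <= 1) by (unfold e; lra).
  destruct (squared_map_expansion e ltac:(lra)) as [a [H0 [H1 [H2 Ha]]]].
  assert (Hexp : normalized_expansion (squared_map e) (fun n => RtoC (a n))).
  { repeat split; trivial; [now rewrite H0|now rewrite H1]. }
  exists (squared_map e), (fun n => RtoC (a n)).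
  split; [split; [split; [split|]|]|split; [exact Hexp|split]].
  + now apply squared_map_holomorphic; lra.
  + intros z w Hz Hw. apply squared_map_injective; trivial; lra.
  + now exists (fun n => RtoC (a n)).
  + now exists (fun n => RtoC (a n)).
  + rewrite H2. f_equal. unfold e. field.
  + now apply squared_map_not_hardy.
Qed.
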